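(* Let $X$ and $Y$ be non-empty discrete proper metric spaces and let $\mathscr{T}$ be $\mathscr{O}$ or $\mathscr{S}^k$ for some $k\in\mathbb{R}_+\cup\{\infty,\omega\}$. If $X$ and $Y$ are quasi-isometric, then the chain complexes $\mathscr{T}\tilde{C}_\bullet(X)$ and $\mathscr{T}\tilde{C}_\bullet(Y)$ are bornologically homotopy equivalent, that is, chain homotopy equivalent with all chain maps and chain homotopies involved being bounded linear maps.
   Context: All vector spaces are real; $\mathbb{R}_+=[0,\infty)$. A bornology on a vector space $V$ is a collection of subsets, called bounded, such that subsets of bounded sets, finite sets, sums $S_1+S_2$ of bounded sets, and $\bigcup_{|t|\le\lambda}tS$ for $S$ bounded and $\lambda\in\mathbb{R}$ are bounded. A linear map is bounded if it maps bounded sets to bounded sets. A discrete metric space $(X,d)$ is proper if its bounded subsets are finite. Fix a base point $\star\in X$ and put $\ell(x)=d(x,\star)$ (the spaces below do not depend on $\star$ up to equivalence). Function spaces. For $k\in\mathbb{R}_+$ let $\mathscr{S}^k(X)$ be the Banach space of $\phi\colon X\to\mathbb{R}$ with $\|\phi\|^k=\sum_{x}|\phi(x)|(\ell(x)+1)^k<\infty$, with the bornology of norm-bounded subsets. Let $\mathscr{S}^\infty(X)=\bigcap_{k\in\mathbb{N}}\mathscr{S}^k(X)$; a subset is bounded if it is bounded for each norm $\|\cdot\|^k$, $k\in\mathbb{N}$. For $\alpha>1$ let $|||\phi|||_\alpha=\sum_x|\phi(x)|\alpha^{\ell(x)}$. Let $\mathscr{O}(X)$ be the space of $\phi$ with $|||\phi|||_\alpha<\infty$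 for all $\alpha>1$; a subset is bounded if it is bounded for every $|||\cdot|||_\alpha$. Let $\mathscr{S}^\omega(X)$ be the space of $\phi$ with $|||\phi|||_\alpha<\infty$ for some $\alpha>1$; a subset is bounded if it is bounded for some $|||\cdot|||_\alpha$ with $\alpha>1$. Tempered chain complexes. For $R\in\mathbb{N}$ let $\mathscr{T}C_n(X)_R$ be the space of functions $\phi\colon X^{n+1}\to\mathbb{R}$ such that $\phi(x_0,\dots,x_n)=0$ whenever $d(x_i,x_j)>R$ for some $i,j$ or $x_j=x_{j+1}$ for some $j$, and such that the function $x\mapsto\sum_{x_1,\dots,x_n}|\phi(x,x_1,\dots,x_n)|$ belongs to $\mathscr{T}(X)$. A subset is bounded if the associated set of functions in $\mathscr{T}(X)$ is bounded. Let $\mathscr{T}C_n(X)=\bigcup_R\mathscr{T}C_n(X)_R$, where a subset is bounded if it is contained and bounded in some $\mathscr{T}C_n(X)_R$. The boundary map $\delta\colon\mathscr{T}C_n(X)\to\mathscr{T}C_{n-1}(X)$ is the bounded extension of $\delta(x_0,\dots,x_n)=\sum_{j=0}^n(-1)^j(x_0,\dots,\widehat{x_j},\dots,x_n)$, where a tuple denotes its characteristic function and tuples with two equal consecutive entries are regarded as $0$. The augmentation is $\alpha\colon\mathscr{T}C_0(X)=\mathscr{T}(X)\to\mathbb{R}$, $\alpha(\phi)=\sum_x\phi(x)$. The reduced complex $\mathscr{T}\tilde{C}_\bullet(X)$ has $\mathscr{T}\tilde{C}_0(X)=\ker\alpha$ and $\mathscr{T}\tilde{C}_n(X)=\mathscr{T}C_n(X)$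 for $n\ge1$, with boundary map $\delta$. *)

(* Defs.v *)
From mathcomp Require Import all_boot all_order all_algebra.
From mathcomp Require Import all_classical all_reals all_analysis.

Set Implicit Arguments.
Unset Strict Implicit.
Unset Printing Implicit Defensive.

Import Order.TTheory GRing.Theory Num.Theory.
Import numFieldNormedType.Exports.

Local Open Scope classical_set_scope.
Local Open Scope ring_scope.

Section MetricSpaces.
Context {R : realType}.

Definition discrete_metric (X : metricType R) : Prop :=
  forall x : X, open [set x].

Definition metric_bounded (X : metricType R) (A : set X) : Prop :=
  exists (x : X) (r : R), forall y, A y -> mdist x y <= r.

Definition proper_metric (X : metricType R) : Prop :=
  forall A : set X, metric_bounded A -> finite_set A.

Definition quasi_isometry (X Y : metricType R) (f : X -> Y) : Prop :=
  (exists L C : R, [/\ 1 <= L, 0 <= C &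
     forall x x', L^-1 * mdist x x' - C <= mdist (f x) (f x')
                  <= L * mdist x x' + C]) /\
  (exists C : R, forall y, exists x, mdist (f x) y <= C).

Definition quasi_isometric (X Y : metricType R) : Prop :=
  exists f : X -> Y, quasi_isometry f.

End MetricSpaces.

(* Signed summation over a possibly infinite index type; it is the usual sum
   whenever f is absolutely summable, and is only applied to such f below. *)
Definition tsum {R : realType} (I : choiceType) (f : I -> R) : R :=
  fine (\esum_(i in [set: I]) (f^\+ i)%:E) -
  fine (\esum_(i in [set: I]) (f^\- i)%:E).

(* Bornological vector spaces and their complexes are given concretely: a
   space is a subset [bcarrier] (in practice a linear subspace) of an ambient
   module together with its bounded subsets.  A map between two such spaces is
   a function between the ambient modules of which only the restriction to the
   carrier matters; all conditions below are relative to the carriers. *)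
Record bornspace (R : realType) := BornSpace {
  bambient : lmodType R ;
  bcarrier : set bambient ;
  bbounded : set (set bambient) }.

Definition bounded_linear {R : realType} (U V : bornspace R)
    (f : bambient U -> bambient V) : Prop :=
  [/\ forall u, bcarrier u -> bcarrier (f u),
      forall (a : R) u v, bcarrier u -> bcarrier v ->
        f (a *: u + v) = a *: f u + f v
    & forall S, bbounded S -> bbounded (f @` S)].

(* Complexes concentrated in degrees >= 0; [bdiff C n] goes from degree n + 1
   to degree n, and the differential out of degree 0 is zero. *)
Record borncomplex (R : realType) := BornComplex {
  bterm : nat -> bornspace R ;
  bdiff : forall n, bambient (bterm n.+1) -> bambient (bterm n) }.
Arguments bdiff {R} b n _.

Section BornologicalHomotopy.
Context {R : realType}.
Implicit Types C D : borncomplex R.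

Definition graded_map C D : Type :=
  forall n, bambient (bterm C n) -> bambient (bterm D n).

Definition bounded_chain_map C D (f : graded_map C D) : Prop :=
  (forall n, bounded_linear (f n)) /\
  (forall n u, bcarrier u -> bdiff D n (f n.+1 u) = f n (bdiff C n u)).

Definition boundedly_homotopic C D (f g : graded_map C D) : Prop :=
  exists h : forall n, bambient (bterm C n) -> bambient (bterm D n.+1),
    [/\ forall n, bounded_linear (h n),
        forall u, bcarrier u -> f 0 u - g 0 u = bdiff D 0 (h 0 u)
      & forall n u, bcarrier u ->
          f n.+1 u - g n.+1 u = bdiff D n.+1 (h n.+1 u) + h n (bdiff C n u)].

Definition bornologically_homotopy_equivalent C D : Prop :=
  exists (f : graded_map C D) (g : graded_map D C),
    [/\ bounded_chain_map f, bounded_chain_map g,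
        boundedly_homotopic (fun n u => g n (f n u)) (fun n u => u)
      & boundedly_homotopic (fun n u => f n (g n u)) (fun n u => u)].

End BornologicalHomotopy.

(* The symbols S^k for k in R_+, S^oo, S^omega and O. *)
Inductive growth (R : realType) : Type :=
  | GrowthS of {nonneg R}
  | GrowthSinfty
  | GrowthSomega
  | GrowthO.

Section FunctionSpaces.
Context {R : realType} (X : metricType R) (x0 : X).

Definition metric_length (x : X) : R := mdist x x0.

(* Both norms take the value +oo exactly outside the corresponding space. *)
Definition poly_norm (k : R) (phi : X -> R) : \bar R :=
  \esum_(x in [set: X]) (`|phi x| * (metric_length x + 1) `^ k)%:E.

Definition exp_norm (a : R) (phi : X -> R) : \bar R :=
  \esum_(x in [set: X]) (`|phi x| * a `^ metric_length x)%:E.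

Definition norm_bounded (N : (X -> R) -> \bar R) (S : set (X -> R)) : Prop :=
  exists M : R, forall phi, S phi -> (N phi <= M%:E)%E.

Definition function_space (T : growth R) : set (X -> R) :=
  match T with
  | GrowthS k => [set phi | (poly_norm k%:num phi < +oo)%E]
  | GrowthSinfty => [set phi | forall k : nat, (poly_norm k%:R phi < +oo)%E]
  | GrowthSomega =>
      [set phi | exists2 a : R, 1 < a & (exp_norm a phi < +oo)%E]
  | GrowthO => [set phi | forall a : R, 1 < a -> (exp_norm a phi < +oo)%E]
  end.

(* Bounded sets are automatically contained in [function_space T]. *)
Definition function_bounded (T : growth R) : set (set (X -> R)) :=
  match T with
  | GrowthS k => [set S | norm_bounded (poly_norm k%:num) S]
  | GrowthSinfty => [set S | forall k : nat, norm_bounded (poly_norm k%:R) S]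
  | GrowthSomega =>
      [set S | exists2 a : R, 1 < a & norm_bounded (exp_norm a) S]
  | GrowthO => [set S | forall a : R, 1 < a -> norm_bounded (exp_norm a) S]
  end.

End FunctionSpaces.

Section TemperedChains.
Context {R : realType} (T : growth R) (X : metricType R) (x0 : X).

Definition nondegenerate n (t : n.-tuple X) : bool :=
  sorted (fun a b => a != b) t.

(* The sum is finite as soon as X is proper and phi has bounded propagation,
   so [fine] loses nothing in that case. *)
Definition row_mass n (phi : n.+1.-tuple X -> R) (x : X) : R :=
  fine (\esum_(t in [set: n.-tuple X]) `|phi [tuple of x :: t]|%:E).

Definition tempered_chain_at n (r : nat) : set (n.+1.-tuple X -> R) :=
  [set phi |
    [/\ forall t i j, r%:R < mdist (tnth t i) (tnth t j) -> phi t = 0,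
        forall t, ~~ nondegenerate t -> phi t = 0
      & function_space x0 T (row_mass phi)]].

Definition tempered_chain n : set (n.+1.-tuple X -> R) :=
  [set phi | exists r, tempered_chain_at r phi].

Definition tempered_bounded n : set (set (n.+1.-tuple X -> R)) :=
  [set S | exists r, S `<=` tempered_chain_at r /\
                     function_bounded x0 T (@row_mass n @` S)].

Definition face n (t : n.+2.-tuple X) (j : 'I_n.+2) : n.+1.-tuple X :=
  [tuple tnth t (lift j i) | i < n.+1].

(* The chain denoted by a tuple: 0 if the tuple is degenerate. *)
Definition tuple_chain n (t s : n.-tuple X) : R :=
  (nondegenerate t && (s == t))%:R.

Definition tuple_boundary n (t : n.+2.-tuple X) (s : n.+1.-tuple X) : R :=
  \sum_(j < n.+2) (-1) ^+ j * tuple_chain (face t j) s.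

(* Bounded extension of [tuple_boundary]: pointwise sum of phi(t) * delta(t).
   For tempered phi over a proper X only finitely many t contribute to the
   value at a given s. *)
Definition boundary n (phi : n.+2.-tuple X -> R) : n.+1.-tuple X -> R :=
  fun s => tsum (fun t => phi t * tuple_boundary t s).

Definition augmentation (phi : 1.-tuple X -> R) : R :=
  tsum (fun x : X => phi [tuple x]).

Definition reduced_chain n : set (n.+1.-tuple X -> R) :=
  match n with
  | 0 => [set phi | tempered_chain phi /\ augmentation phi = 0]
  | n'.+1 => @tempered_chain n'.+1
  end.

(* [R^o] only serves to view functions into R as a module over R. *)
Definition reduced_term n : bornspace R :=
  @BornSpace R (n.+1.-tuple X -> R^o) (@reduced_chain n)
    [set S | S `<=` @reduced_chain n /\ tempered_bounded S].

Definition reduced_complex : borncomplex R :=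
  @BornComplex R reduced_term (fun n => @boundary n).

End TemperedChains.

(* Main.v *)
From Pilot Require Import Defs.
From mathcomp Require Import all_boot all_order all_algebra.
From mathcomp Require Import all_classical all_reals all_analysis.
From mathcomp Require Import ring lra zify.
(* [nondegenerate] is also a property of bilinear forms; here it always means
   that consecutive vertices of a tuple differ. *)
Import Pilot.Defs.

(** Every map between chains used here sends a simplex to an alternating sum of
    simplices whose number of terms depends only on the degree: the boundary,
    the map induced by [f : X -> Y], and the prism operator of two maps [f] and
    [g].  These maps on simplices are extended to chains by
    [linear_extension].

    Algebra.  A tempered chain is absolutely summable: all weights are at least
    1, and in a proper space bounded propagation makes every row finite
    ([tempered_abs_summable]).  For absolutely summable chains and uniformly
    bounded kernels, sums may be exchanged ([exchange_tsum]), so that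
    extensions compose as the maps on simplices do ([linear_extension_comp]).
    Every identity between chain operators thus reduces to an identity for one
    simplex: faces commute with induced maps, and the prism [P] between [f]
    and [g] satisfies [dP + Pd = g - f] ([boundary_prismS]).  Degenerate
    simplices, which represent zero, cause no trouble because boundary, induced
    map and prism all vanish on them.

    Estimates.  A coarsely Lipschitz map changes the length function at most
    affinely, [l (f x) <= A * l x + B].  This multiplies a polynomial weight by
    at most a constant and replaces the base [a] of an exponential weight by
    [a ^ A], which the quantifiers over the bases in [O] and [S^omega] absorb
    ([function_bounded_transfer]).  The norm of the row masses of a chain is a
    weighted [l^1] norm over simplices, weighted at the first vertex, and such
    norms are controlled by [esum_linear_extension_le]; collecting terms along
    the fibres of [f], however large, does not increase an [l^1] norm.

    Conclusion.  A quasi-isometry [f] has a coarse inverse [g], also coarsely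
    Lipschitz, with [g \o f] and [f \o g] at bounded distance from the
    identities.  The induced maps are bounded chain maps that preserve the
    augmentation, and the prism operators of the pairs [(id, g \o f)] and
    [(id, f \o g)] are bounded homotopies
    ([pushforward_inverse_homotopic]). *)

Set Implicit Arguments.
Unset Strict Implicit.
Unset Printing Implicit Defensive.

Import Order.TTheory GRing.Theory Num.Theory.

Local Open Scope classical_set_scope.
Local Open Scope ring_scope.

(** * Signed sums of absolutely summable families *)

Section SignedSums.
Context {R : realType}.
Implicit Types I J : choiceType.

Definition abs_summable I (f : I -> R) : Prop :=
  (\esum_(i in [set: I]) `|f i|%:E < +oo)%E.

Lemma esumZl I (f : I -> \bar R) (r : R) : 0 <= r -> (forall i, (0 <= f i)%E) ->
  (\esum_(i in [set: I]) (r%:E * f i) = r%:E * \esum_(i in [set: I]) f i)%E.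
Proof.
move=> r0 f0; rewrite /esum -ereal_supZl//; last first.
  apply/set0P; exists 0%E; exists set0; first exact: fsets_set0.
  by rewrite fsbig_set0.
rewrite image_comp; congr ereal_sup; apply: eq_imagel => A [finA _] /=.
by rewrite ge0_mule_fsumr.
Qed.

Lemma le_abs_summable I (f g : I -> R) :
  abs_summable g -> (forall i, `|f i| <= `|g i|) -> abs_summable f.
Proof.
by move=> sg fg; apply: le_lt_trans sg; apply: le_esum => i _; rewrite lee_fin.
Qed.

Lemma abs_summableD I (f g : I -> R) :
  abs_summable f -> abs_summable g -> abs_summable (fun i => f i + g i).
Proof. by move=> sf sg; apply: (@summableD _ _ _ (EFin \o f) (EFin \o g)). Qed.

Lemma abs_summableZ I (a : R) (f : I -> R) :
  abs_summable f -> abs_summable (fun i => a * f i).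
Proof.
move=> sf; rewrite /abs_summable.
under eq_esum do rewrite normrM EFinM.
by rewrite esumZl// lte_mul_pinfty.
Qed.

Lemma abs_summable_fin_num I (f : I -> R) : abs_summable f ->
  (\esum_(i in [set: I]) `|f i|%:E)%E \is a fin_num.
Proof. by move=> sf; rewrite ge0_fin_numE// esum_ge0. Qed.

Lemma esum_summable_fin_num I (f : I -> R) : (forall i, 0 <= f i) ->
  abs_summable f -> (\esum_(i in [set: I]) (f i)%:E)%E \is a fin_num.
Proof.
move=> f0 sf; rewrite ge0_fin_numE; last by apply: esum_ge0 => i _; rewrite lee_fin.
by move: sf; rewrite /abs_summable; under eq_esum do rewrite ger0_norm//.
Qed.

Lemma tsum_ge0 I (f : I -> R) : (forall i, 0 <= f i) ->
  tsum f = fine (\esum_(i in [set: I]) (f i)%:E)%E.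
Proof.
move=> f0; rewrite /tsum [X in _ - fine X]esum1 ?subr0.
  by congr fine; apply: eq_esum => i _; rewrite (@ge0_funrposE _ _ setT)// inE.
by move=> i _; rewrite (@ge0_funrnegE _ _ setT)// inE.
Qed.

Lemma abs_summable_funrpos I (f : I -> R) : abs_summable f -> abs_summable f^\+.
Proof.
move=> sf; apply: le_abs_summable sf _ => i; rewrite ger0_norm ?funrpos_ge0//.
by rewrite -[leRHS]/((Num.norm \o f) i) -funrposDneg lerDl funrneg_ge0.
Qed.

Lemma abs_summable_funrneg I (f : I -> R) : abs_summable f -> abs_summable f^\-.
Proof.
move=> sf; apply: le_abs_summable sf _ => i; rewrite ger0_norm ?funrneg_ge0//.
by rewrite -[leRHS]/((Num.norm \o f) i) -funrposDneg lerDr funrpos_ge0.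
Qed.

(** Any way of writing a family as a difference of nonnegative summable families
    computes its sum; linearity is deduced from this freedom. *)
Lemma tsumB_ge0 I (f g : I -> R) : (forall i, 0 <= f i) -> (forall i, 0 <= g i) ->
  abs_summable f -> abs_summable g ->
  tsum (fun i => f i - g i) = tsum f - tsum g.
Proof.
move=> f0 g0 sf sg.
have sfg : abs_summable (fun i => f i - g i).
  exact: (@summableB _ _ _ (EFin \o f) (EFin \o g)).
rewrite (tsum_ge0 f0) (tsum_ge0 g0) /tsum -!fineB ?esum_summable_fin_num//.
- congr fine.
  rewrite -(@esumB R I setT (EFin \o f) (EFin \o g))//;
    try by move=> i _; rewrite /= lee_fin.
  have -> : ((EFin \o f) \- (EFin \o g))%E = EFin \o (fun i => f i - g i) by [].
  by rewrite funerpos funerneg.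
- exact: abs_summable_funrpos.
- exact: abs_summable_funrneg.
Qed.

Lemma tsum_posneg I (f : I -> R) : tsum f = tsum f^\+ - tsum f^\-.
Proof. by rewrite [tsum f^\+]tsum_ge0// [tsum f^\-]tsum_ge0. Qed.

Lemma tsumD_ge0 I (f g : I -> R) : (forall i, 0 <= f i) -> (forall i, 0 <= g i) ->
  abs_summable f -> abs_summable g ->
  tsum (fun i => f i + g i) = tsum f + tsum g.
Proof.
move=> f0 g0 sf sg; rewrite !tsum_ge0//; last by move=> i; exact: addr_ge0.
rewrite -fineD ?esum_summable_fin_num// -esumD//.
by move=> i _; rewrite lee_fin.
by move=> i _; rewrite lee_fin.
Qed.

Lemma tsumD I (f g : I -> R) : abs_summable f -> abs_summable g ->
  tsum (fun i => f i + g i) = tsum f + tsum g.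
Proof.
move=> sf sg.
have [? ?] := (abs_summable_funrpos sf, abs_summable_funrneg sf).
have [? ?] := (abs_summable_funrpos sg, abs_summable_funrneg sg).
have -> : (fun i => f i + g i) =
    (fun i => (f^\+ i + g^\+ i) - (f^\- i + g^\- i)).
  by apply/funext => i; exact: (congr1 (fun h : I -> R => h i) (esym (funrDB f g))).
have pos (h : I -> R) i : 0 <= h^\+ i by exact: funrpos_ge0.
have neg (h : I -> R) i : 0 <= h^\- i by exact: funrneg_ge0.
rewrite tsumB_ge0; last 4 first.
- by move=> i; rewrite addr_ge0.
- by move=> i; rewrite addr_ge0.
- exact: abs_summableD.
- exact: abs_summableD.
by rewrite !tsumD_ge0// (tsum_posneg f) (tsum_posneg g) opprD addrACA.
Qed.

Lemma tsumZ I (a : R) (f : I -> R) : abs_summable f ->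
  tsum (fun i => a * f i) = a * tsum f.
Proof.
move=> sf; have [sp sn] := (abs_summable_funrpos sf, abs_summable_funrneg sf).
have pos (h : I -> R) i : 0 <= h^\+ i by exact: funrpos_ge0.
have neg (h : I -> R) i : 0 <= h^\- i by exact: funrneg_ge0.
have Z (b : R) (g : I -> R) : 0 <= b -> (forall i, 0 <= g i) -> abs_summable g ->
    tsum (fun i => b * g i) = b * tsum g.
  move=> b0 g0 sg; rewrite !tsum_ge0//; last by move=> i; exact: mulr_ge0.
  under eq_esum do rewrite EFinM.
  by rewrite esumZl// fineM// esum_summable_fin_num.
rewrite tsum_posneg (tsum_posneg f); have [a0|/ltW a0] := leP 0 a.
  by rewrite mulrBr ge0_funrposM// ge0_funrnegM// (Z a f^\+)// (Z a f^\-).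
rewrite le0_funrposM// le0_funrnegM// (Z _ f^\-) ?oppr_ge0// (Z _ f^\+) ?oppr_ge0//.
by ring.
Qed.

Lemma tsum_sum I N (F : 'I_N -> I -> R) : (forall k, abs_summable (F k)) ->
  abs_summable (fun i => \sum_k F k i) /\
  tsum (fun i => \sum_k F k i) = \sum_k tsum (F k).
Proof.
elim: N F => [|N IHN] F sF.
  have -> : (fun i => \sum_k F k i) = (fun=> 0).
    by apply/funext => i; rewrite big_ord0.
  split; first by rewrite /abs_summable esum1// => i _; rewrite normr0.
  by rewrite tsum_ge0// esum1// big_ord0.
have [sF' IHF] := IHN (fun k => F (lift ord0 k)) (fun k => sF _).
have E : (fun i => \sum_k F k i) =
    (fun i => F ord0 i + \sum_k F (lift ord0 k) i).
  by apply/funext => i; rewrite big_ord_recl.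
rewrite E; split; first exact: abs_summableD.
by rewrite tsumD// IHF big_ord_recl.
Qed.

Lemma esum_single I (f : I -> \bar R) (i0 : I) :
  (0 <= f i0)%E -> (forall i, i != i0 -> f i = 0%E) ->
  (\esum_(i in [set: I]) f i)%E = f i0.
Proof.
move=> fp f0; rewrite -[RHS](@esum_set1 R I i0 f)// [RHS]esum_mkcond.
by apply: eq_esum => i _; case: ifPn => //; rewrite notin_setE /= => /eqP /f0 ->.
Qed.

Lemma normr_tsum_le I (f : I -> R) :
  (`|tsum f|%:E <= \esum_(i in [set: I]) `|f i|%:E)%E.
Proof.
have [sf|] := ltP (\esum_(i in [set: I]) `|f i|%:E)%E +oo%E; last first.
  by rewrite leye_eq => /eqP ->; rewrite leey.
have [sp sn] := (abs_summable_funrpos sf, abs_summable_funrneg sf).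
apply: (@le_trans _ _ (\esum_(i in [set: I]) ((f^\+ i)%:E + (f^\- i)%:E))%E).
  rewrite esumD; try by move=> i _; rewrite lee_fin.
  rewrite /tsum -[X in (_ <= X + _)%E]fineK ?esum_summable_fin_num//.
  rewrite -[X in (_ <= _ + X)%E]fineK ?esum_summable_fin_num//.
  rewrite -EFinD lee_fin (le_trans (ler_normB _ _))// !ger0_norm//.
    by apply/fine_ge0/esum_ge0 => i _; rewrite lee_fin.
  by apply/fine_ge0/esum_ge0 => i _; rewrite lee_fin.
apply: le_esum => i _; rewrite -EFinD lee_fin.
by rewrite -[leRHS]/((Num.norm \o f) i) -funrposDneg.
Qed.

Lemma tsum_single I (f : I -> R) (i0 : I) : (forall i, i != i0 -> f i = 0) ->
  tsum f = f i0.
Proof.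
move=> f0.
have E (g : R -> R) : g 0 = 0 -> 0 <= g (f i0) ->
    (\esum_(i in [set: I]) (g (f i))%:E = (g (f i0))%:E)%E.
  move=> g0 gp; apply: (esum_single (f := fun i => (g (f i))%:E)) => // i /f0 ->.
  by rewrite g0.
have /= Ep := E (Num.max^~ 0); have /= En := E (fun x => Num.max (- x) 0).
rewrite tsum_posneg !tsum_ge0;
  try by [move=> i; exact: funrpos_ge0 | move=> i; exact: funrneg_ge0].
rewrite /funrpos /funrneg Ep ?maxxx// ?En ?oppr0 ?maxxx// ?le_max ?lexx ?orbT//.
exact: (congr1 (fun h : I -> R => h i0) (funrposBneg f)).
Qed.

Lemma reindex_tsum I J (e : I -> J) (f : J -> R) : bijective e ->
  tsum f = tsum (f \o e).
Proof.
move=> be; rewrite /tsum.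
have sb : set_bij [set: I] [set: J] e by rewrite setTT_bijective.
by rewrite (reindex_esum _ _ e _ sb) (reindex_esum _ _ e _ sb).
Qed.

Lemma exchange_esum I J (a : I -> J -> \bar R) : (forall i j, (0 <= a i j)%E) ->
  (\esum_(i in [set: I]) \esum_(j in [set: J]) a i j =
   \esum_(j in [set: J]) \esum_(i in [set: I]) a i j)%E.
Proof.
move=> a0; rewrite !esum_esum//.
rewrite (@reindex_esum R (J * I)%type (I * J)%type
  ([set: J] `*`` (fun=> [set: I])) _ (fun x => (x.2, x.1)))//.
split=> //= [[j i] [j' i'] _ _ [-> ->]//|[i j] _].
by exists (j, i).
Qed.

Lemma esum2_abs_summable I J (a : I -> J -> R) :
  (\esum_(i in [set: I]) \esum_(j in [set: J]) `|a i j|%:E < +oo)%E ->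
  forall i, abs_summable (a i).
Proof.
move=> sa i; apply: le_lt_trans sa.
rewrite -[leLHS](@esum_set1 R I i (fun k => \esum_(j in [set: J]) `|a k j|%:E)%E).
  rewrite esum_mkcond; apply: le_esum => k _; case: ifP => // _.
  by apply: esum_ge0 => j _; rewrite lee_fin.
by apply: esum_ge0 => j _; rewrite lee_fin.
Qed.

(** For nonnegative families both iterated sums are suprema over finite sets of
    pairs; the finiteness hypothesis only ensures that [fine] loses nothing. *)
Lemma exchange_tsum_ge0 I J (a : I -> J -> R) : (forall i j, 0 <= a i j) ->
  (\esum_(i in [set: I]) \esum_(j in [set: J]) `|a i j|%:E < +oo)%E ->
  abs_summable (fun i => tsum (a i)) /\
  tsum (fun i => tsum (a i)) = tsum (fun j => tsum (a^~ j)).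
Proof.
move=> a0 sa.
have inner I' J' (b : I' -> J' -> R) : (forall i j, 0 <= b i j) ->
    (\esum_(i in [set: I']) \esum_(j in [set: J']) `|b i j|%:E < +oo)%E ->
    forall i, ((tsum (b i))%:E = \esum_(j in [set: J']) `|b i j|%:E)%E.
  move=> b0 sb i; have := esum2_abs_summable sb i.
  move=> /(esum_summable_fin_num (b0 i)) bfin.
  rewrite tsum_ge0// fineK//; apply: eq_esum => j _; by rewrite ger0_norm.
have sa' : (\esum_(j in [set: J]) \esum_(i in [set: I]) `|a i j|%:E < +oo)%E.
  by rewrite exchange_esum// => i j; rewrite lee_fin.
have E := inner _ _ a a0 sa.
have E' := inner _ _ (fun j i => a i j) (fun j i => a0 i j) sa'.
have t0 i : 0 <= tsum (a i).
  by rewrite -lee_fin E; apply: esum_ge0 => j _; rewrite lee_fin.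
have t0' j : 0 <= tsum (a^~ j).
  by rewrite -lee_fin E'; apply: esum_ge0 => i _; rewrite lee_fin.
split.
  by rewrite /abs_summable; under eq_esum do rewrite ger0_norm// E.
rewrite !tsum_ge0//; congr fine.
under eq_esum do rewrite E; rewrite exchange_esum; last by move=> i j; rewrite lee_fin.
by apply: eq_esum => j _; rewrite E'.
Qed.

(** Fubini, by splitting the family into its positive and negative parts. *)
Lemma exchange_tsum I J (a : I -> J -> R) :
  (\esum_(i in [set: I]) \esum_(j in [set: J]) `|a i j|%:E < +oo)%E ->
  tsum (fun i => tsum (a i)) = tsum (fun j => tsum (a^~ j)).
Proof.
move=> sa.
pose p i j : R := Num.max (a i j) 0; pose n i j : R := Num.max (- a i j) 0.
have p0 i j : 0 <= p i j by rewrite le_max lexx orbT.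
have n0 i j : 0 <= n i j by rewrite le_max lexx orbT.
have le_p i j : `|p i j| <= `|a i j|.
  by rewrite ger0_norm// ge_max ler_norm normr_ge0.
have le_n i j : `|n i j| <= `|a i j|.
  by rewrite ger0_norm// ge_max -(normrN (a i j)) ler_norm normr_ge0.
have dom (b : I -> J -> R) : (forall i j, `|b i j| <= `|a i j|) ->
    (\esum_(i in [set: I]) \esum_(j in [set: J]) `|b i j|%:E < +oo)%E.
  move=> le_b; apply: le_lt_trans sa; apply: le_esum => i _; apply: le_esum => j _.
  by rewrite lee_fin.
have flip (b : I -> J -> R) : (forall i j, `|b i j| <= `|a i j|) ->
    (\esum_(j in [set: J]) \esum_(i in [set: I]) `|b i j|%:E < +oo)%E.
  by move=> /dom; rewrite exchange_esum// => i j; rewrite lee_fin.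
have [sp Ep] := exchange_tsum_ge0 p0 (dom p le_p).
have [sn En] := exchange_tsum_ge0 n0 (dom n le_n).
have [sp' _] :=
  @exchange_tsum_ge0 _ _ (fun j i => p i j) (fun j i => p0 i j) (flip p le_p).
have [sn' _] :=
  @exchange_tsum_ge0 _ _ (fun j i => n i j) (fun j i => n0 i j) (flip n le_n).
have tp I' (h : I' -> R) : (forall i, 0 <= h i) -> 0 <= tsum h.
  by move=> h0; rewrite tsum_ge0//; apply/fine_ge0/esum_ge0 => i _; rewrite lee_fin.
transitivity (tsum (fun i => tsum (p i)) - tsum (fun i => tsum (n i))).
  rewrite -tsumB_ge0//; try by move=> i; exact: tp.
  by congr tsum; apply/funext => i; rewrite tsum_posneg.
rewrite Ep En -tsumB_ge0//; try by move=> i; exact: tp.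
by congr tsum; apply/funext => j; rewrite [RHS]tsum_posneg.
Qed.

End SignedSums.

(** * Linear extension of maps on simplices *)

Section FinitelySupportedKernels.
Context {R : realType} {I : choiceType} {Y : metricType R} {m N : nat}.
Variable sigma : I -> 'I_N -> m.-tuple Y.

(** The signs are fixed to [(-1) ^+ k] since boundary, prisms and (with [N = 1])
    induced maps all have them. *)
Definition alternating_chain (t : I) : m.-tuple Y -> R :=
  fun s => \sum_(k < N) (-1) ^+ k * tuple_chain (sigma t k) s.

Definition linear_extension (J : Type) (K : I -> J -> R) (phi : I -> R) : J -> R :=
  fun s => tsum (fun t => phi t * K t s).

Lemma normr_tuple_chain_le (t s : m.-tuple Y) : `|tuple_chain t s| <= (s == t)%:R.
Proof.
by rewrite /tuple_chain; case: (nondegenerate t); case: eqP;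
  rewrite /= ?normr1 ?normr0.
Qed.

Lemma normr_alternating_chain_le t s :
  `|alternating_chain t s| <= \sum_(k < N) (s == sigma t k)%:R.
Proof.
apply: le_trans (ler_norm_sum _ _ _) _; apply: ler_sum => k _.
by rewrite normrM normrX normrN1 expr1n mul1r normr_tuple_chain_le.
Qed.

Lemma normr_alternating_chain_leN t s : `|alternating_chain t s| <= N%:R.
Proof.
apply: le_trans (normr_alternating_chain_le t s) _.
rewrite -[leRHS](_ : \sum_(k < N) 1 = N%:R); last by rewrite sumr_const card_ord.
by apply: ler_sum => k _; case: eqP.
Qed.

Lemma esum_alternating_chain_le (w : m.-tuple Y -> R) t : (forall s, 0 <= w s) ->
  (\esum_(s in [set: m.-tuple Y]) (`|alternating_chain t s| * w s)%:E
    <= (\sum_(k < N) w (sigma t k))%:E)%E.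
Proof.
move=> w0.
apply: (@le_trans _ _
  (\esum_(s in [set: m.-tuple Y]) \sum_(k < N) ((s == sigma t k)%:R * w s)%:E)%E).
  apply: le_esum => s _; rewrite sumEFin lee_fin -mulr_suml ler_wpM2r//.
  exact: normr_alternating_chain_le.
rewrite esum_sum; last by move=> s k _ _; rewrite lee_fin mulr_ge0.
rewrite -sumEFin; apply: lee_sum => k _; rewrite (esum_single (i0 := sigma t k)).
- by rewrite eqxx mul1r.
- by rewrite lee_fin mulr_ge0.
- by move=> s /negPf ->; rewrite mul0r.
Qed.

Let D := linear_extension alternating_chain.

(** The weighted [l^1] estimate behind all boundedness statements: exchange the
    two sums and use that one simplex contributes at most [N] terms of
    coefficient 1 in absolute value. *)
Lemma esum_linear_extension_le (w : m.-tuple Y -> R) (phi : I -> R) :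
  (forall s, 0 <= w s) ->
  (\esum_(s in [set: m.-tuple Y]) (`|D phi s| * w s)%:E <=
   \esum_(t in [set: I]) (`|phi t| * \sum_(k < N) w (sigma t k))%:E)%E.
Proof.
move=> w0.
apply: (@le_trans _ _ (\esum_(s in [set: m.-tuple Y]) \esum_(t in [set: I])
    (`|phi t| * (`|alternating_chain t s| * w s))%:E)%E).
  apply: le_esum => s _.
  under [leRHS]eq_esum => t _ do rewrite mulrA mulrC EFinM.
  rewrite esumZl//.
  rewrite (mulrC _ (w s)) EFinM lee_wpmul2l ?lee_fin//.
  by under [leRHS]eq_esum do rewrite -normrM; exact: normr_tsum_le.
rewrite exchange_esum; last by move=> s t; rewrite lee_fin !mulr_ge0.
apply: le_esum => t _.
under eq_esum => s _ do rewrite EFinM.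
rewrite esumZl//; last by move=> s; rewrite lee_fin mulr_ge0.
by rewrite [leRHS]EFinM lee_wpmul2l ?lee_fin// esum_alternating_chain_le.
Qed.

Lemma abs_summable_alternating_term (phi : I -> R) s : abs_summable phi ->
  abs_summable (fun t => phi t * alternating_chain t s).
Proof.
move=> sphi; apply: le_abs_summable (abs_summableZ N%:R sphi) _ => t.
by rewrite !normrM mulrC ler_wpM2r// [leRHS]ger0_norm// normr_alternating_chain_leN.
Qed.

Lemma linear_extension_linear (a : R) (phi psi : I -> R) s :
  abs_summable phi -> abs_summable psi ->
  D (fun t => a * phi t + psi t) s = a * D phi s + D psi s.
Proof.
move=> sphi spsi; have sp := abs_summable_alternating_term s sphi.
rewrite /D /linear_extension -tsumZ// -tsumD//.
- by congr tsum; apply/funext => t; rewrite mulrDl mulrA.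
- exact: abs_summableZ.
- exact: abs_summable_alternating_term.
Qed.

(** Transposition of the extension against a bounded function.  With the columns
    of a second kernel for [psi] this gives composition of extensions, with
    [psi = 1] compatibility with the augmentation. *)
Lemma linear_extension_pairing (phi : I -> R) (psi : m.-tuple Y -> R) (c : R) :
  abs_summable phi -> (forall s, `|psi s| <= c) ->
  tsum (fun s => D phi s * psi s) = tsum (fun t => phi t *
    \sum_(k < N) (-1) ^+ k * ((nondegenerate (sigma t k))%:R * psi (sigma t k))).
Proof.
move=> sphi psic.
have inner t : tsum (fun s => phi t * alternating_chain t s * psi s) =
    phi t * \sum_(k < N) (-1) ^+ k * ((nondegenerate (sigma t k))%:R * psi (sigma t k)).
  pose F (k : 'I_N) s := phi t * ((-1) ^+ k * (tuple_chain (sigma t k) s * psi s)).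
  have F0 (k : 'I_N) s : s != sigma t k -> F k s = 0.
    by rewrite /F /tuple_chain => /negPf ->; rewrite andbF mul0r !mulr0.
  have sF (k : 'I_N) : abs_summable (F k).
    rewrite /abs_summable (esum_single (i0 := sigma t k)) ?ltry ?lee_fin//.
    by move=> s /F0 ->; rewrite normr0.
  rewrite mulr_sumr.
  transitivity (tsum (fun s => \sum_(k < N) F k s)).
    congr tsum; apply/funext => s; rewrite -mulrA mulr_suml mulr_sumr.
    by apply: eq_bigr => k _; rewrite /F !mulrA.
  have [_ ->] := tsum_sum sF; apply: eq_bigr => k _.
  by rewrite (tsum_single (@F0 k)) /F /tuple_chain eqxx andbT.
have outer s : tsum (fun t => phi t * alternating_chain t s * psi s) = D phi s * psi s.
  rewrite mulrC -tsumZ; last exact: abs_summable_alternating_term.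
  by congr tsum; apply/funext => t; rewrite mulrC.
under [in LHS]eq_fun do rewrite -outer.
under [in RHS]eq_fun do rewrite -inner.
symmetry; apply: exchange_tsum.
apply: (@le_lt_trans _ _ (\esum_(t in [set: I]) (`|phi t| * \sum_(k < N) `|c|)%:E)%E).
  apply: le_esum => t _.
  under eq_esum do rewrite -mulrA normrM EFinM.
  rewrite esumZl// EFinM lee_wpmul2l ?lee_fin//.
  apply: le_trans (esum_alternating_chain_le t (fun=> normr_ge0 c)).
  apply: le_esum => s _; rewrite lee_fin normrM ler_wpM2l//.
  exact: le_trans (psic s) (ler_norm c).
under eq_esum do rewrite mulrC EFinM.
by rewrite esumZl ?sumr_ge0// lte_mul_pinfty// lee_fin sumr_ge0.
Qed.

(** What makes images of chains nondegenerate and of bounded propagation. *)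
Lemma linear_extension_neq0 (phi : I -> R) s : D phi s != 0 ->
  exists t k, [/\ phi t != 0, s = sigma t k & nondegenerate s].
Proof.
move=> /eqP D0; apply: contrapT => H; apply: D0.
rewrite /D /linear_extension -[RHS](_ : @tsum R I (fun=> 0) = 0); last first.
  by rewrite tsum_ge0// esum1.
congr tsum; apply/funext => t.
have [->|phit] := eqVneq (phi t) 0; first by rewrite mul0r.
rewrite [X in _ * X](_ : _ = 0) ?mulr0//; rewrite /alternating_chain big1// => k _.
rewrite /tuple_chain; case: (boolP (_ && _)); last by rewrite mulr0.
move=> /andP[nd /eqP st]; exfalso; apply: H; exists t, k; split=> //.
by rewrite st.
Qed.

End FinitelySupportedKernels.

(** * Faces and prisms of one simplex *)

Section SimplicialIdentities.
Context {R : realType}.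

(** The cancellation in the prism formula, with [A i j] for face [j] of prism [i],
    [B i j] for prism [i] of face [j], and [M i] for the simplex that follows
    [f] before vertex [i] and [g] from there on.  Faces off the two
    diagonals cancel against the prisms of faces; the faces [i] and [i.+1] of
    prism [i] telescope. *)
Lemma alternating_double_sum (m : nat) (A B : nat -> nat -> R) (M : nat -> R) :
  (forall i j, (j < i <= m)%N -> A i j = B i.-1 j) ->
  (forall i, (i <= m)%N -> A i i = M i) ->
  (forall i, (i <= m)%N -> A i i.+1 = M i.+1) ->
  (forall i j, (i.+1 < j <= m.+1)%N -> A i j = B i j.-1) ->
  \sum_(0 <= i < m.+1) (-1) ^+ i * (\sum_(0 <= j < m.+2) (-1) ^+ j * A i j) +
  \sum_(0 <= j < m.+1) (-1) ^+ j * (\sum_(0 <= i < m) (-1) ^+ i * B i j) =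
  M 0 - M m.+1.
Proof.
move=> Alow Adiag Asup Aupp.
pose S i j : R := (-1) ^+ i * ((-1) ^+ j * B i j).
have rowE i : (i < m.+1)%N ->
    (-1) ^+ i * (\sum_(0 <= j < m.+2) (-1) ^+ j * A i j) =
    - (\sum_(0 <= j < i) S i.-1 j) + (M i - M i.+1) -
    \sum_(i.+1 <= j < m.+1) S i j.
  move=> im; rewrite (@big_cat_nat _ _ _ i)//=; last exact: (leqW (ltnW im)).
  (* Row [i] splits into [j < i], the diagonal pair [i], [i.+1], and [j > i.+1]. *)
  rewrite (@big_cat_nat _ _ _ i.+2 i)//=; last by rewrite -addn2 leq_addr.
  rewrite [X in _ * (_ + (X + _))]big_ltn// big_nat1 !mulrDr.
  rewrite Adiag// Asup//.
  have -> : (-1) ^+ i * (\sum_(0 <= j < i) (-1) ^+ j * A i j) =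
            - \sum_(0 <= j < i) S i.-1 j.
    rewrite mulr_sumr -sumrN; apply: eq_big_nat => j /andP[_ ji].
    rewrite Alow ?ji// /S; case: i ji {im} => // i _ /=.
    by rewrite exprS; ring.
  have -> : (-1) ^+ i * (\sum_(i.+2 <= j < m.+2) (-1) ^+ j * A i j) =
            - \sum_(i.+1 <= j < m.+1) S i j.
    rewrite big_add1 /= mulr_sumr -sumrN; apply: eq_big_nat => j /andP[ij jm].
    by rewrite Aupp /= ?ltnS ?ij// /S exprS; ring.
  have sq : (-1) ^+ i * (-1) ^+ i = 1 :> R by rewrite -expr2 sqrr_sign.
  have -> : (-1) ^+ i * ((-1) ^+ i * M i) = M i by rewrite mulrA sq mul1r.
  have -> : (-1) ^+ i * ((-1) ^+ i.+1 * M i.+1) = - M i.+1.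
    by rewrite exprS mulN1r mulrA mulrN sq mulN1r.
  by ring.
rewrite (eq_big_nat _ _ (F2 := fun i => - (\sum_(0 <= j < i) S i.-1 j) +
  (M i - M i.+1) - \sum_(i.+1 <= j < m.+1) S i j)); last first.
  by move=> i /andP[_ im]; exact: rowE.
rewrite big_split /= big_split /= !sumrN.
have -> : \sum_(0 <= i < m.+1) (M i - M i.+1) = M 0 - M m.+1.
  rewrite -(opprB (M m.+1)) -telescope_sumr// -sumrN.
  by apply: eq_bigr => i _; rewrite opprB.
have -> : \sum_(0 <= j < m.+1) (-1) ^+ j * (\sum_(0 <= i < m) (-1) ^+ i * B i j) =
    \sum_(0 <= i < m) \sum_(0 <= j < m.+1) S i j.
  rewrite exchange_big_nat /=; apply: eq_bigr => j _; rewrite mulr_sumr.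
  by apply: eq_bigr => i _; rewrite /S mulrCA.
have -> : \sum_(0 <= i < m.+1) \sum_(0 <= j < i) S i.-1 j =
    \sum_(0 <= i < m) \sum_(0 <= j < i.+1) S i j.
  by rewrite big_nat_recl// [X in X + _]big_geq// add0r.
have -> : \sum_(0 <= i < m.+1) \sum_(i.+1 <= j < m.+1) S i j =
    \sum_(0 <= i < m) \sum_(i.+1 <= j < m.+1) S i j.
  by rewrite big_nat_recr//= [X in _ + X]big_geq// addr0.
have -> : \sum_(0 <= i < m) \sum_(0 <= j < m.+1) S i j =
    \sum_(0 <= i < m) \sum_(0 <= j < i.+1) S i j +
    \sum_(0 <= i < m) \sum_(i.+1 <= j < m.+1) S i j.
  rewrite -big_split /=; apply: eq_big_nat => i /andP[_ im].
  by rewrite -big_cat_nat//= ltnW.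
by ring.
Qed.

Lemma nth_mktupleE (T : Type) N (F : nat -> T) (y : T) k : (k < N)%N ->
  nth y [tuple F i | i < N] k = F k.
Proof. by move=> kN; rewrite -[k]/(nat_of_ord (Ordinal kN)) nth_mktuple. Qed.

Lemma eq_tuple_nth (T : Type) N (y : T) (t s : N.-tuple T) :
  (forall k, (k < N)%N -> nth y t k = nth y s k) -> t = s.
Proof.
move=> ts; apply/val_inj/(@eq_from_nth _ y); first by rewrite !size_tuple.
by rewrite size_tuple.
Qed.

Lemma degenerateP (X : metricType R) n (x : X) (t : n.-tuple X) :
  reflect (exists2 p, (p.+1 < n)%N & nth x t p = nth x t p.+1)
    (~~ nondegenerate t).
Proof.
apply: (iffP idP) => [|[p pn tp]].
  move=> /negP nd; apply: contrapT => H; apply: nd; apply/(sortedP x) => p.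
  by rewrite size_tuple => pn; apply/eqP => tp; apply: H; exists p.
apply/negP => /(sortedP x)/(_ p); rewrite size_tuple => /(_ pn).
by rewrite tp eqxx.
Qed.

Lemma tuple_chain_degenerate (X : metricType R) n (t s : n.-tuple X) :
  ~~ nondegenerate t -> tuple_chain t s = 0.
Proof. by rewrite /tuple_chain => /negPf ->. Qed.

Lemma nth_face (X : metricType R) n (x : X) (t : n.+2.-tuple X) (j : 'I_n.+2) k :
  (k < n.+1)%N -> nth x (face t j) k = nth x t (bump j k).
Proof.
move=> kn; rewrite -[k]/(nat_of_ord (Ordinal kn)) nth_mktuple.
by rewrite (tnth_nth x).
Qed.

(** If vertices [p] and [p.+1] agree, the faces [p] and [p.+1] coincide and cancel,
    and all others are still degenerate. *)
Lemma tuple_boundary_degenerate (X : metricType R) n (t : n.+2.-tuple X) s :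
  ~~ nondegenerate t -> tuple_boundary t s = 0.
Proof.
pose x := thead t; move=> /(degenerateP x)[p pn tp].
have pn' : (p < n.+2)%N by exact: ltnW.
pose j0 : 'I_n.+2 := Ordinal pn'; pose j1 : 'I_n.+2 := Ordinal pn.
rewrite /tuple_boundary (bigD1 j0)//= (bigD1 j1)//=; last first.
  by rewrite -val_eqE /= eqn_leq ltnn.
rewrite big1 ?addr0 => [|j /andP[jj0 jj1]].
  rewrite exprS mulN1r mulNr (_ : face t j0 = face t j1) ?subrr//.
  apply: (eq_tuple_nth (y := x)) => k kn; rewrite !nth_face// /bump /=.
  by case: (ltngtP p k) => [pk|pk|<-]; rewrite ?add0n ?add1n.
rewrite tuple_chain_degenerate ?mulr0//; apply/(degenerateP x).
move: jj0 jj1; rewrite -!val_eqE /= => jj0 jj1.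
(* Removing a vertex before the repetition shifts it down by one. *)
have [jp|pj] := ltnP j p.
  exists p.-1; first by lia.
  have pE : p.-1.+1 = p by lia.
  rewrite !nth_face; try by lia.
  have -> : bump j p.-1 = p by rewrite /bump; lia.
  by have -> : bump j p.-1.+1 = p.+1 by rewrite /bump; lia.
have jn := ltn_ord j; exists p; first by lia.
rewrite !nth_face; try by lia.
have -> : bump j p = p by rewrite /bump; lia.
by have -> : bump j p.+1 = p.+1 by rewrite /bump; lia.
Qed.

Section Prisms.
Variables (X Y : metricType R) (f g : X -> Y).

Lemma map_tuple_degenerate n (t : n.-tuple X) :
  ~~ nondegenerate t -> ~~ nondegenerate (map_tuple f t).
Proof.
case: n t => [|n] t; first by rewrite tuple0.
move=> /(degenerateP (thead t))[p pn tp].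
apply/(degenerateP (f (thead t))); exists p => //.
by rewrite !(nth_map (thead t)) ?size_tuple ?tp// ltnW.
Qed.

Lemma face_map_tuple n (t : n.+2.-tuple X) j :
  face (map_tuple f t) j = map_tuple f (face t j).
Proof. by apply: eq_from_tnth => k; rewrite !(tnth_map, tnth_mktuple). Qed.

Definition prism n (t : n.+1.-tuple X) (i : nat) : n.+2.-tuple Y :=
  [tuple if (k <= i)%N then f (nth (thead t) t k) else g (nth (thead t) t k.-1)
   | k < n.+2].

Definition interpolation n (t : n.+1.-tuple X) (i : nat) : n.+1.-tuple Y :=
  [tuple if (k < i)%N then f (nth (thead t) t k) else g (nth (thead t) t k)
   | k < n.+1].

Lemma nth_prism n (x : X) (y : Y) (t : n.+1.-tuple X) i k :
  (i <= n)%N -> (k < n.+2)%N ->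
  nth y (prism t i) k = if (k <= i)%N then f (nth x t k) else g (nth x t k.-1).
Proof.
move=> i_n kn.
rewrite (nth_mktupleE
  (fun k => if (k <= i)%N then f (nth (thead t) t k) else g (nth (thead t) t k.-1)))//.
by case: leqP => ki; congr (_ _); apply: set_nth_default; rewrite size_tuple; lia.
Qed.

Lemma nth_interpolation n (x : X) (y : Y) (t : n.+1.-tuple X) i k :
  (k < n.+1)%N ->
  nth y (interpolation t i) k = if (k < i)%N then f (nth x t k) else g (nth x t k).
Proof.
move=> kn.
rewrite (nth_mktupleE
  (fun k => if (k < i)%N then f (nth (thead t) t k) else g (nth (thead t) t k)))//.
by case: ltnP => ki; congr (_ _); apply: set_nth_default; rewrite size_tuple.
Qed.

(** A repetition at [p] survives among the [f]-vertices when [p < i], and among the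
    [g]-vertices, shifted by one, otherwise. *)
Lemma prism_degenerate n (t : n.+1.-tuple X) i : (i <= n)%N ->
  ~~ nondegenerate t -> ~~ nondegenerate (prism t i).
Proof.
move=> i_n; pose x := thead t; move=> /(degenerateP x)[p pn tp].
apply/(degenerateP (f x)); have [pi|ip] := ltnP p i.
  exists p; first by lia.
  by rewrite !(nth_prism x)//; [rewrite pi (ltnW pi) tp|lia|lia].
exists p.+1; first by [].
rewrite !(nth_prism x)//=; last by lia.
by rewrite !ifN ?tp// -ltnNge; lia.
Qed.

Lemma nth_face_prism n (x : X) (y : Y) (t : n.+1.-tuple X) i (j : 'I_n.+2) k :
  (i <= n)%N -> (k < n.+1)%N -> nth y (face (prism t i) j) k =
  if (bump j k <= i)%N then f (nth x t (bump j k)) else g (nth x t (bump j k).-1).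
Proof.
by move=> i_n kn; rewrite nth_face// (nth_prism x)// /bump; lia.
Qed.

Lemma nth_prism_face n (x : X) (y : Y) (t : n.+2.-tuple X) i (j : 'I_n.+2) k :
  (i <= n)%N -> (k < n.+2)%N -> nth y (prism (face t j) i) k =
  if (k <= i)%N then f (nth x t (bump j k)) else g (nth x t (bump j k.-1)).
Proof.
move=> i_n kn; rewrite (nth_prism x)//.
by case: leqP => ki; rewrite nth_face//; lia.
Qed.

Lemma face_prism_lt n (t : n.+2.-tuple X) i (j : 'I_n.+3) (j' : 'I_n.+2) :
  (j < i <= n.+1)%N -> j' = j :> nat ->
  face (prism t i) j = prism (face t j') i.-1.
Proof.
move=> /andP[ji i_n] j'j; pose x := thead t.
apply: (eq_tuple_nth (y := f x)) => k kn.
rewrite (nth_face_prism x)// (nth_prism_face x)//; last by lia.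
case: ifPn => c1; case: ifPn => c2;
  first [congr (f (nth x t _)) | congr (g (nth x t _)) | exfalso];
  move: c1 c2; rewrite /bump ?j'j; lia.
Qed.

Lemma face_prism_diag n (t : n.+1.-tuple X) i (j : 'I_n.+2) :
  (i <= n)%N -> j = i :> nat -> face (prism t i) j = interpolation t i.
Proof.
move=> i_n ji; pose x := thead t.
apply: (eq_tuple_nth (y := f x)) => k kn.
rewrite (nth_face_prism x)// (nth_interpolation x)//.
case: ifPn => c1; case: ifPn => c2;
  first [congr (f (nth x t _)) | congr (g (nth x t _)) | exfalso];
  move: c1 c2; rewrite /bump ?ji; lia.
Qed.

Lemma face_prism_superdiag n (t : n.+1.-tuple X) i (j : 'I_n.+2) :
  (i <= n)%N -> j = i.+1 :> nat -> face (prism t i) j = interpolation t i.+1.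
Proof.
move=> i_n ji; pose x := thead t.
apply: (eq_tuple_nth (y := f x)) => k kn.
rewrite (nth_face_prism x)// (nth_interpolation x)//.
case: ifPn => c1; case: ifPn => c2;
  first [congr (f (nth x t _)) | congr (g (nth x t _)) | exfalso];
  move: c1 c2; rewrite /bump ?ji; lia.
Qed.

Lemma face_prism_gt n (t : n.+2.-tuple X) i (j : 'I_n.+3) (j' : 'I_n.+2) :
  (i.+1 < j)%N -> j' = j.-1 :> nat ->
  face (prism t i) j = prism (face t j') i.
Proof.
move=> ij j'j; pose x := thead t; have jn := ltn_ord j.
apply: (eq_tuple_nth (y := f x)) => k kn.
rewrite (nth_face_prism x)//; last by lia.
rewrite (nth_prism_face x)//; last by lia.
case: ifPn => c1; case: ifPn => c2;
  first [congr (f (nth x t _)) | congr (g (nth x t _)) | exfalso];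
  move: c1 c2; rewrite /bump ?j'j; lia.
Qed.

Lemma interpolation0 n (t : n.+1.-tuple X) : interpolation t 0 = map_tuple g t.
Proof.
apply: (eq_tuple_nth (y := g (thead t))) => k kn.
by rewrite (nth_interpolation (thead t))// (nth_map (thead t)) ?size_tuple.
Qed.

Lemma interpolation_full n (t : n.+1.-tuple X) :
  interpolation t n.+1 = map_tuple f t.
Proof.
apply: (eq_tuple_nth (y := f (thead t))) => k kn.
by rewrite (nth_interpolation (thead t))// kn (nth_map (thead t)) ?size_tuple.
Qed.

Definition prism_chain n (t : n.+1.-tuple X) : n.+2.-tuple Y -> R :=
  alternating_chain (fun t (i : 'I_n.+1) => prism t i) t.

Lemma prism_chain_degenerate n (t : n.+1.-tuple X) s :
  ~~ nondegenerate t -> prism_chain t s = 0.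
Proof.
move=> ndt; rewrite /prism_chain /alternating_chain big1// => i _.
rewrite tuple_chain_degenerate ?mulr0//; apply: prism_degenerate => //.
by rewrite -ltnS.
Qed.

Lemma boundary_prism0 (t : 1.-tuple X) s :
  \sum_(i < 1) (-1) ^+ i * tuple_boundary (prism t i) s =
  tuple_chain (map_tuple g t) s - tuple_chain (map_tuple f t) s.
Proof.
have := @alternating_double_sum 0
  (fun i j => tuple_chain (face (prism t i) (inord j)) s) (fun _ _ => 0)
  (fun i => tuple_chain (interpolation t i) s).
rewrite interpolation0 interpolation_full => <-.
- rewrite big_mkord [X in _ + X]big1 ?addr0.
    apply: eq_bigr => i _; rewrite big_mkord; congr (_ * _).
    by apply: eq_bigr => j _; rewrite inord_val.
  by move=> j _; rewrite big_geq ?mulr0.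
- by move=> i j; lia.
- by move=> i i0; rewrite (@face_prism_diag _ _ i)// inordK//; lia.
- by move=> i i0; rewrite (@face_prism_superdiag _ _ i)// inordK//; lia.
- by move=> i j; lia.
Qed.

Lemma boundary_prismS n (t : n.+2.-tuple X) s :
  \sum_(i < n.+2) (-1) ^+ i * tuple_boundary (prism t i) s +
  \sum_(j < n.+2) (-1) ^+ j * prism_chain (face t j) s =
  tuple_chain (map_tuple g t) s - tuple_chain (map_tuple f t) s.
Proof.
have := @alternating_double_sum n.+1
  (fun i j => tuple_chain (face (prism t i) (inord j)) s)
  (fun i j => tuple_chain (prism (face t (inord j)) i) s)
  (fun i => tuple_chain (interpolation t i) s).
rewrite interpolation0 interpolation_full => <-.
- rewrite !big_mkord; congr (_ + _); apply: eq_bigr => i _; rewrite big_mkord;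
    congr (_ * _); apply: eq_bigr => j _; by rewrite inord_val.
- by move=> i j ij; rewrite (@face_prism_lt _ t i (inord j) (inord j))// !inordK//; lia.
- by move=> i i0; rewrite (@face_prism_diag _ _ i)// inordK//; lia.
- by move=> i i0; rewrite (@face_prism_superdiag _ _ i)// inordK//; lia.
- by move=> i j ij; rewrite (@face_prism_gt _ t i (inord j) (inord j.-1))// !inordK//; lia.
Qed.

End Prisms.
End SimplicialIdentities.

(** * Induced maps and prism operators on chains *)

Section ChainOperators.
Context {R : realType}.

Definition bounded_kernel (I J : Type) (K : I -> J -> R) : Prop :=
  exists c : R, forall i j, `|K i j| <= c.

Lemma abs_summable_bounded_kernel (I : choiceType) J (K : I -> J -> R) phi j :
  bounded_kernel K -> abs_summable phi -> abs_summable (fun i => phi i * K i j).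
Proof.
move=> [c Kc] sphi; apply: le_abs_summable (abs_summableZ c sphi) _ => i.
by rewrite !normrM mulrC ler_wpM2r// (le_trans (Kc i j))// ler_norm.
Qed.

Lemma linear_extensionD (I : choiceType) J (K L : I -> J -> R) phi j :
  bounded_kernel K -> bounded_kernel L -> abs_summable phi ->
  linear_extension (fun i j => K i j + L i j) phi j =
  linear_extension K phi j + linear_extension L phi j.
Proof.
move=> bK bL sphi; rewrite /linear_extension -tsumD;
  try exact: abs_summable_bounded_kernel.
by congr tsum; apply/funext => i; rewrite mulrDr.
Qed.

Lemma linear_extensionN (I : choiceType) J (K : I -> J -> R) phi j :
  bounded_kernel K -> abs_summable phi ->
  linear_extension (fun i j => - K i j) phi j = - linear_extension K phi j.
Proof.
move=> bK sphi; rewrite /linear_extension -[RHS]mulN1r -tsumZ;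
  last exact: abs_summable_bounded_kernel.
by congr tsum; apply/funext => i; rewrite mulN1r mulrN.
Qed.

Lemma bounded_kernel_comp (I J L : Type) N (tau : I -> 'I_N -> J) (K : J -> L -> R) :
  bounded_kernel K ->
  bounded_kernel (fun i l => \sum_(k < N) (-1) ^+ k * K (tau i k) l).
Proof.
move=> [c Kc]; exists (\sum_(k < N) c) => i l.
apply: le_trans (ler_norm_sum _ _ _) _; apply: ler_sum => k _.
by rewrite normrM normrX normrN1 expr1n mul1r.
Qed.

Lemma bounded_kernelN (I J : Type) (K : I -> J -> R) :
  bounded_kernel K -> bounded_kernel (fun i j => - K i j).
Proof. by move=> [c Kc]; exists c => i j; rewrite normrN. Qed.

Lemma bounded_alternating_chain (I : choiceType) (Y : metricType R) m N
    (sigma : I -> 'I_N -> m.-tuple Y) : bounded_kernel (alternating_chain sigma).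
Proof. by exists N%:R => t s; exact: normr_alternating_chain_leN. Qed.

(** The hypothesis on degenerate simplices is what allows the terms discarded by
    the first extension to be restored under the second. *)
Lemma linear_extension_comp (I : choiceType) (Y : metricType R) m N J
    (sigma : I -> 'I_N -> m.-tuple Y) (K : m.-tuple Y -> J -> R) phi j :
  bounded_kernel K -> (forall s j, ~~ nondegenerate s -> K s j = 0) ->
  abs_summable phi ->
  linear_extension K (linear_extension (alternating_chain sigma) phi) j =
  linear_extension (fun t j => \sum_(k < N) (-1) ^+ k * K (sigma t k) j) phi j.
Proof.
move=> [c Kc] K0 sphi.
rewrite /linear_extension (linear_extension_pairing sigma sphi (fun s => Kc s j)).
congr tsum; apply/funext => t; congr (_ * _); apply: eq_bigr => k _; congr (_ * _).
by case: (boolP (nondegenerate _)) => [|/K0 ->]; rewrite ?mul1r ?mulr0.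
Qed.

Definition chain_pushforward (X Y : metricType R) (f : X -> Y) n :
    (n.-tuple X -> R) -> n.-tuple Y -> R :=
  linear_extension (alternating_chain (fun t (_ : 'I_1) => map_tuple f t)).

Definition prism_operator (X Y : metricType R) (f g : X -> Y) n :
    (n.+1.-tuple X -> R) -> n.+2.-tuple Y -> R :=
  linear_extension (prism_chain f g (n := n)).

Lemma boundaryE (X : metricType R) n (phi : n.+2.-tuple X -> R) :
  boundary phi = linear_extension (alternating_chain (@face R X n)) phi.
Proof. by []. Qed.

Lemma alternating_chain1 (I : choiceType) (Y : metricType R) m
    (tau : I -> m.-tuple Y) t s :
  alternating_chain (fun t (_ : 'I_1) => tau t) t s = tuple_chain (tau t) s.
Proof. by rewrite /alternating_chain big_ord1 expr0 mul1r. Qed.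

Lemma pushforward_kernel_degenerate (X Y : metricType R) (f : X -> Y) n
    (t : n.-tuple X) s : ~~ nondegenerate t ->
  alternating_chain (fun t (_ : 'I_1) => map_tuple f t) t s = 0.
Proof.
move=> ndt; rewrite alternating_chain1 tuple_chain_degenerate//.
exact: map_tuple_degenerate.
Qed.

Lemma boundary_pushforward (X Y : metricType R) (f : X -> Y) n
    (phi : n.+2.-tuple X -> R) : abs_summable phi ->
  boundary (chain_pushforward f phi) = chain_pushforward f (boundary phi).
Proof.
move=> sphi; apply/funext => s; rewrite !boundaryE.
rewrite /chain_pushforward !linear_extension_comp//.
- congr tsum; apply/funext => t; congr (_ * _).
  rewrite big_ord1 expr0 mul1r; apply: eq_bigr => j _.
  by rewrite alternating_chain1 face_map_tuple.
- exact: bounded_alternating_chain.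
- by move=> t u; exact: pushforward_kernel_degenerate.
- exact: bounded_alternating_chain.
- by move=> t u; exact: tuple_boundary_degenerate.
Qed.

Lemma pushforward_comp (X Y Z : metricType R) (f : X -> Y) (g : Y -> Z) n
    (phi : n.-tuple X -> R) : abs_summable phi ->
  chain_pushforward g (chain_pushforward f phi) = chain_pushforward (g \o f) phi.
Proof.
move=> sphi; apply/funext => s; rewrite /chain_pushforward linear_extension_comp//.
- congr tsum; apply/funext => t; congr (_ * _).
  rewrite big_ord1 expr0 mul1r !alternating_chain1; congr tuple_chain.
  by apply: eq_from_tnth => i; rewrite !tnth_map.
- exact: bounded_alternating_chain.
- by move=> t u; exact: pushforward_kernel_degenerate.
Qed.

(** The induced map of the identity is the projection killing degenerate simplices,
    hence the hypothesis. *)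
Lemma pushforward_id (X : metricType R) n (phi : n.-tuple X -> R) :
  (forall t, ~~ nondegenerate t -> phi t = 0) -> chain_pushforward id phi = phi.
Proof.
move=> phi0; apply/funext => s; rewrite /chain_pushforward /linear_extension.
have idE (t : n.-tuple X) : map_tuple id t = t.
  by apply: eq_from_tnth => i; rewrite tnth_map.
rewrite (tsum_single (i0 := s)) => [|t ts].
  rewrite alternating_chain1 idE /tuple_chain eqxx andbT.
  by case: (boolP (nondegenerate s)) => [|/phi0 ->]; rewrite ?mulr1 ?mul0r.
by rewrite alternating_chain1 idE /tuple_chain eq_sym (negPf ts) andbF mulr0.
Qed.

Lemma prism_kernel_bounded (X Y : metricType R) (f g : X -> Y) n :
  bounded_kernel (prism_chain f g (n := n)).
Proof. exact: bounded_alternating_chain. Qed.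

Lemma boundary_prism_operator0 (X Y : metricType R) (f g : X -> Y)
    (phi : 1.-tuple X -> R) s : abs_summable phi ->
  boundary (prism_operator f g phi) s =
  chain_pushforward g phi s - chain_pushforward f phi s.
Proof.
move=> sphi; rewrite boundaryE /prism_operator linear_extension_comp//; last 2 first.
- exact: bounded_alternating_chain.
- by move=> t u; exact: tuple_boundary_degenerate.
rewrite /chain_pushforward -linear_extensionN//; last exact: bounded_alternating_chain.
rewrite -linear_extensionD//; last 2 first.
- exact: bounded_alternating_chain.
- by apply: bounded_kernelN; exact: bounded_alternating_chain.
congr tsum; apply/funext => t; congr (_ * _); rewrite !alternating_chain1.
exact: boundary_prism0.
Qed.

Lemma boundary_prism_operatorS (X Y : metricType R) (f g : X -> Y) n
    (phi : n.+2.-tuple X -> R) s : abs_summable phi ->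
  boundary (prism_operator f g phi) s + prism_operator f g (boundary phi) s =
  chain_pushforward g phi s - chain_pushforward f phi s.
Proof.
move=> sphi; rewrite boundaryE /prism_operator linear_extension_comp//; last 2 first.
- exact: bounded_alternating_chain.
- by move=> t u; exact: tuple_boundary_degenerate.
rewrite boundaryE linear_extension_comp//; last 2 first.
- exact: prism_kernel_bounded.
- by move=> t u; exact: prism_chain_degenerate.
rewrite /chain_pushforward -linear_extensionN//; last exact: bounded_alternating_chain.
rewrite -!linear_extensionD//; try by [exact: bounded_alternating_chain |
  apply: bounded_kernelN; exact: bounded_alternating_chain |
  apply: bounded_kernel_comp; exact: bounded_alternating_chain].
congr tsum; apply/funext => t; congr (_ * _); rewrite !alternating_chain1.
exact: boundary_prismS.
Qed.

Lemma augmentation_pushforward (X Y : metricType R) (f : X -> Y)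
    (phi : 1.-tuple X -> R) : abs_summable phi ->
  augmentation (chain_pushforward f phi) = augmentation phi.
Proof.
move=> sphi.
have aug (Z : metricType R) (psi : 1.-tuple Z -> R) : augmentation psi = tsum psi.
  rewrite /augmentation [RHS](reindex_tsum (e := fun x => [tuple x]))//.
  exists (fun t => thead t) => [x|t]; first by [].
  by apply/val_inj; case/tupleP: t => x t; rewrite (tuple0 t).
rewrite !aug /chain_pushforward.
transitivity (tsum (fun s : 1.-tuple Y => chain_pushforward f phi s * 1)).
  by congr tsum; apply/funext => s; rewrite mulr1.
rewrite (@linear_extension_pairing _ _ _ _ _ _ _ (fun=> 1) 1)//; last first.
  by move=> _; rewrite normr1.
congr tsum; apply/funext => t; rewrite big_ord1 expr0 mul1r mulr1.
rewrite (_ : nondegenerate _) ?mulr1//.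
by case/tupleP: t => x t; rewrite (tuple0 t).
Qed.

End ChainOperators.

(** * Change of weights *)

Section Weights.
Context {R : realType}.

Definition weighted_norm (X : metricType R) (x0 : X) (omega : R -> R)
    (phi : X -> R) : \bar R :=
  (\esum_(x in [set: X]) (`|phi x| * omega (mdist x x0))%:E)%E.

(** Stated for all pairs of weight functions of the length at once, so that one
    estimate serves all growth types. *)
Definition dominated_mass (X Y : metricType R) (x0 : X) (y0 : Y) (A B : R) (N : R)
    (phi : X -> R) (psi : Y -> R) : Prop :=
  forall (omX omY : R -> R) (c : R),
    (forall a, 0 <= omX a) -> (forall a, 0 <= omY a) -> 0 <= c ->
    (forall a b, 0 <= a -> 0 <= b -> a <= A * b + B -> omY a <= c * omX b) ->
    (weighted_norm y0 omY psi <= (N * c)%:E * weighted_norm x0 omX phi)%E.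

Lemma weighted_norm_ge0 (X : metricType R) (x0 : X) omega phi :
  (forall a, 0 <= omega a) -> (0 <= weighted_norm x0 omega phi)%E.
Proof. by move=> om0; apply: esum_ge0 => x _; rewrite lee_fin mulr_ge0. Qed.

Lemma poly_weight_le (A B k a b : R) : 0 <= A -> 0 <= B -> 0 <= k ->
  0 <= a -> 0 <= b -> a <= A * b + B ->
  (a + 1) `^ k <= (A + B + 1) `^ k * (b + 1) `^ k.
Proof.
move=> A0 B0 k0 a0 b0 ab; rewrite -powRM; [|lra|lra].
apply: ge0_ler_powR => //; rewrite ?nnegrE; first lra.
  by apply: mulr_ge0; lra.
have := mulr_ge0 B0 b0; lra.
Qed.

(** The base of the exponential weight changes from [alpha] to [alpha `^ A]. *)
Lemma exp_weight_le (A B alpha a b : R) : 1 < alpha -> a <= A * b + B ->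
  alpha `^ a <= alpha `^ B * (alpha `^ A) `^ b.
Proof.
move=> a1 ab; rewrite -powRrM -powRD; last by apply/implyP => _; rewrite gt_eqF//; lra.
by apply: ler_powR; [exact: ltW|rewrite addrC].
Qed.

Lemma powR_gt1 (alpha A : R) : 1 < alpha -> 0 < A -> 1 < alpha `^ A.
Proof.
move=> a1 A0; have <- : (1 : R) `^ A = 1 by rewrite powR1.
by apply: gt0_ltr_powR => //; rewrite nnegrE; lra.
Qed.

Lemma function_space_bounded1 (X : metricType R) (x0 : X) T phi :
  function_space x0 T phi <-> function_bounded x0 T [set phi].
Proof.
have fin (omega : R -> R) : (forall a, 0 <= omega a) ->
    (weighted_norm x0 omega phi < +oo)%E <->
    norm_bounded (weighted_norm x0 omega) [set phi].
  move=> om0; split=> [fphi|[M /(_ phi erefl) phiM]]; last first.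
    exact: le_lt_trans phiM (ltry _).
  exists (fine (weighted_norm x0 omega phi)) => _ ->; rewrite fineK//.
  by rewrite ge0_fin_numE ?weighted_norm_ge0.
have fpoly k := fin (fun a => (a + 1) `^ k) (fun a => powR_ge0 _ _).
have fexp al := fin (fun a => al `^ a) (fun a => powR_ge0 _ _).
case: T => [k| | |] /=.
- exact: fpoly.
- by split=> H k; apply/fpoly; exact: H.
- by split=> -[al al1 H]; exists al => //; apply/fexp.
- by split=> H al al1; apply/fexp; exact: H.
Qed.

(** Polynomial weights keep their exponent and cost a constant.  For exponential
    weights the base is adjusted: with all bases available, base [al] on [Y]
    is served by [al `^ A] on [X]; with a single base [al] given on [X], the
    base [al `^ A^-1 > 1] works on [Y]. *)
Lemma function_bounded_transfer (X Y : metricType R) (x0 : X) (y0 : Y) A B N T S S' :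
  1 <= A -> 0 <= B -> 0 <= N ->
  (forall psi, S' psi -> exists2 phi, S phi & dominated_mass x0 y0 A B N phi psi) ->
  function_bounded x0 T S -> function_bounded y0 T S'.
Proof.
move=> A1 B0 N0 dom; have A0 : 0 <= A by lra.
have step (omX omY : R -> R) (c : R) :
    (forall a, 0 <= omX a) -> (forall a, 0 <= omY a) -> 0 <= c ->
    (forall a b, 0 <= a -> 0 <= b -> a <= A * b + B -> omY a <= c * omX b) ->
    norm_bounded (weighted_norm x0 omX) S -> norm_bounded (weighted_norm y0 omY) S'.
  move=> oX oY c0 H [M SM]; exists (N * c * M) => psi /dom[phi Sphi D].
  apply: le_trans (D omX omY c oX oY c0 H) _.
  by rewrite [leRHS]EFinM lee_wpmul2l ?lee_fin ?mulr_ge0// SM.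
have spoly k : 0 <= k -> norm_bounded (poly_norm x0 k) S ->
    norm_bounded (poly_norm y0 k) S'.
  move=> k0; apply: (step (fun a => (a + 1) `^ k) (fun a => (a + 1) `^ k)
    ((A + B + 1) `^ k)); try by move=> *; exact: powR_ge0.
  by move=> a b a0 b0 ab; exact: poly_weight_le.
have sexp al : 1 < al -> norm_bounded (exp_norm x0 (al `^ A)) S ->
    norm_bounded (exp_norm y0 al) S'.
  move=> al1; apply: (step (fun a => (al `^ A) `^ a) (fun a => al `^ a)
    (al `^ B)); try by move=> *; exact: powR_ge0.
  by move=> a b a0 b0 ab; exact: exp_weight_le.
case: T => [k| | |] /=.
- exact: spoly.
- by move=> H k; apply: spoly => //; exact: H.
- move=> [al al1 H]; exists (al `^ A^-1).
    by apply: powR_gt1; rewrite ?invr_gt0; lra.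
  apply: sexp; first by apply: powR_gt1; rewrite ?invr_gt0; lra.
  by rewrite -powRrM mulVf ?powRr1//; lra.
- by move=> H al al1; apply: sexp => //; apply: H; apply: powR_gt1 => //; lra.
Qed.

(** All weights are at least 1. *)
Lemma function_space_abs_summable (X : metricType R) (x0 : X) T phi :
  function_space x0 T phi -> abs_summable phi.
Proof.
have sub (omega : R -> R) : (forall a, 0 <= a -> 1 <= omega a) ->
    (weighted_norm x0 omega phi < +oo)%E -> abs_summable phi.
  move=> om1; apply: le_lt_trans; apply: le_esum => x _.
  by rewrite lee_fin ler_peMr// om1// mdist_ge0.
have spoly k : 0 <= k -> (poly_norm x0 k phi < +oo)%E -> abs_summable phi.
  move=> k0; apply: (sub (fun a => (a + 1) `^ k)) => a a0.
  by rewrite -[leLHS](powRr0 (a + 1)); apply: ler_powR => //; lra.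
have sexp al : 1 < al -> (exp_norm x0 al phi < +oo)%E -> abs_summable phi.
  move=> al1; apply: (sub (fun a => al `^ a)) => a a0.
  by rewrite -[leLHS](powRr0 al); apply: ler_powR => //; lra.
case: T => [k| | |] /=.
- exact: spoly.
- by move=> /(_ 0); exact: spoly.
- by move=> [al al1]; exact: sexp al1.
- by move=> H; apply: (sexp 2); [|apply: H]; rewrite ltr1n.
Qed.

End Weights.

(** * Tempered chains as weighted summable families *)

Section RowMasses.
Context {R : realType}.

Lemma esum_tuple_cons (X : choiceType) n (F : n.+1.-tuple X -> \bar R) :
  (forall t, (0 <= F t)%E) ->
  (\esum_(t in [set: n.+1.-tuple X]) F t =
   \esum_(x in [set: X]) \esum_(t in [set: n.-tuple X]) F [tuple of x :: t])%E.
Proof.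
move=> F0; rewrite esum_esum//.
rewrite (@reindex_esum R (X * n.-tuple X)%type _
  ([set: X] `*`` (fun=> [set: n.-tuple X])) _ (fun p => [tuple of p.1 :: p.2]))//.
split=> //= [[x t] [x' t'] _ _ /(congr1 val)/= [-> tt']|t _].
  by congr (_, _); exact: val_inj.
by exists (thead t, [tuple of behead t]) => //=; exact/esym/tuple_eta.
Qed.

Lemma esum_finite_support (I : choiceType) (f : I -> R) (A : set I) :
  finite_set A -> (forall i, ~ A i -> f i = 0) -> abs_summable f.
Proof.
move=> finA fA; rewrite /abs_summable.
have -> : (\esum_(i in [set: I]) `|f i|%:E = \esum_(i in A) `|f i|%:E)%E.
  rewrite [RHS]esum_mkcond; apply: eq_esum => i _; case: ifPn => //.
  by rewrite notin_setE => /fA ->; rewrite normr0.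
rewrite esum_fset//.
by rewrite fsumEFin// ltry.
Qed.

Lemma finite_tuples_in (X : choiceType) n (A : set X) : finite_set A ->
  finite_set [set t : n.-tuple X | forall i, A (tnth t i)].
Proof.
move=> finA; elim: n => [|n IHn].
  apply: (@sub_finite_set _ _ [set [tuple]]); last exact: finite_set1.
  by move=> t _ /=; rewrite tuple0.
pose cons_pair (p : X * n.-tuple X) := [tuple of p.1 :: p.2].
apply: sub_finite_set (finite_image cons_pair (finite_setX finA IHn)).
move=> t /= tA; exists (thead t, [tuple of behead t]); last exact/esym/tuple_eta.
by split=> [|i] /=; rewrite ?tnth_behead; exact: tA.
Qed.

(** All vertices lie in the ball of radius [r] around [x], which is finite. *)
Lemma abs_summable_row (X : metricType R) n (phi : n.+1.-tuple X -> R) (r : R) :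
  proper_metric X ->
  (forall t i j, r < mdist (tnth t i) (tnth t j) -> phi t = 0) ->
  forall x, abs_summable (fun t : n.-tuple X => phi [tuple of x :: t]).
Proof.
move=> pX phir x.
have finB : finite_set [set y | mdist x y <= r] by apply: pX; exists x, r.
apply: (esum_finite_support (@finite_tuples_in _ n _ finB)) => t /existsNP[i].
move=> /negP; rewrite -ltNge => ri; apply: (phir _ ord0 (lift ord0 i)).
by rewrite tnth0 tnthS.
Qed.

Lemma row_mass_ge0 (X : metricType R) n (phi : n.+1.-tuple X -> R) x :
  0 <= row_mass phi x.
Proof. by apply/fine_ge0/esum_ge0 => t _; rewrite lee_fin. Qed.

Lemma weighted_norm_row_mass (X : metricType R) n (x0 : X) (omega : R -> R)
    (phi : n.+1.-tuple X -> R) : (forall a, 0 <= omega a) ->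
  (forall x, abs_summable (fun t : n.-tuple X => phi [tuple of x :: t])) ->
  weighted_norm x0 omega (row_mass phi) =
  (\esum_(t in [set: n.+1.-tuple X]) (`|phi t| * omega (mdist (thead t) x0))%:E)%E.
Proof.
move=> om0 sphi; rewrite esum_tuple_cons; last by move=> t; rewrite lee_fin mulr_ge0.
apply: eq_esum => x _; rewrite ger0_norm ?row_mass_ge0// mulrC EFinM.
rewrite fineK; last exact: abs_summable_fin_num (sphi x).
rewrite -esumZl//; apply: eq_esum => t _.
by rewrite -EFinM mulrC (_ : thead _ = x).
Qed.

(** Without finiteness of the rows there is still an inequality, because [fine] can
    only decrease a nonnegative value; this suffices for the image of a
    chain. *)
Lemma weighted_norm_row_mass_le (X : metricType R) n (x0 : X) (omega : R -> R)
    (phi : n.+1.-tuple X -> R) : (forall a, 0 <= omega a) ->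
  (weighted_norm x0 omega (row_mass phi) <=
  \esum_(t in [set: n.+1.-tuple X]) (`|phi t| * omega (mdist (thead t) x0))%:E)%E.
Proof.
move=> om0; rewrite esum_tuple_cons; last by move=> t; rewrite lee_fin mulr_ge0.
apply: le_esum => x _; rewrite ger0_norm ?row_mass_ge0// mulrC EFinM.
rewrite (_ : esum _ _ = (omega (mdist x x0))%:E *
    \esum_(t in [set: n.-tuple X]) `|phi [tuple of x :: t]|%:E)%E; last first.
  rewrite -esumZl//; apply: eq_esum => t _.
  by rewrite -EFinM mulrC (_ : thead _ = x).
rewrite lee_wpmul2l ?lee_fin// /row_mass.
have : (0 <= \esum_(t in [set: n.-tuple X]) `|phi [tuple of x :: t]|%:E)%E.
  by apply: esum_ge0 => t _; rewrite lee_fin.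
by case: esum => //= _; rewrite leey.
Qed.

End RowMasses.

Section ControlledFamilies.
Context {R : realType} (T : growth R) (X Y : metricType R) (x0 : X) (y0 : Y).

Lemma tempered_abs_summable n (phi : n.+1.-tuple X -> R) :
  proper_metric X -> tempered_chain T x0 phi -> abs_summable phi.
Proof.
move=> pX [r [phir _ /function_space_abs_summable]].
rewrite /abs_summable esum_tuple_cons; last by move=> t; rewrite lee_fin.
under eq_esum => x _.
  rewrite ger0_norm ?row_mass_ge0// /row_mass fineK; last first.
    exact: abs_summable_fin_num (abs_summable_row pX phir x).
  over.
by [].
Qed.

(** The two bounds needed to stay within tempered chains: the first vertex moves
    affinely in length, and the diameter of a simplex grows affinely. *)
Definition controlled_family n m N (A B : R)
    (sigma : n.+1.-tuple X -> 'I_N -> m.+1.-tuple Y) : Prop :=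
  forall t k,
    mdist (thead (sigma t k)) y0 <= A * mdist (thead t) x0 + B /\
    forall r, (forall i j, mdist (tnth t i) (tnth t j) <= r) ->
      forall i j, mdist (tnth (sigma t k) i) (tnth (sigma t k) j) <= A * r + B.

Variables (n m N : nat) (A B : R) (sigma : n.+1.-tuple X -> 'I_N -> m.+1.-tuple Y).
Hypotheses (A1 : 1 <= A) (B0 : 0 <= B) (sigmaAB : controlled_family A B sigma).
Hypothesis pX : proper_metric X.

Let D := linear_extension (alternating_chain sigma).

Lemma controlled_dominated_mass phi : tempered_chain T x0 phi ->
  dominated_mass x0 y0 A B N%:R (row_mass phi) (row_mass (D phi)).
Proof.
move=> [r [phir _ _]] omX omY c oX oY c0 cXY.
apply: le_trans (weighted_norm_row_mass_le _ _ oY) _.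
rewrite weighted_norm_row_mass//; last exact: abs_summable_row pX phir.
apply: le_trans (esum_linear_extension_le _ _ _) _.
  by move=> s; exact: oY.
rewrite -esumZl ?mulr_ge0//; last by move=> t; rewrite lee_fin mulr_ge0.
apply: le_esum => t _; rewrite -EFinM lee_fin.
apply: (@le_trans _ _ (`|phi t| * \sum_(k < N) (c * omX (mdist (thead t) x0)))).
  apply: ler_wpM2l => //; apply: ler_sum => k _.
  by apply: cXY; rewrite ?mdist_ge0//; have [] := sigmaAB t k.
rewrite sumr_const card_ord -mulr_natl le_eqVlt; apply/orP; left; apply/eqP.
by ring.
Qed.

Lemma controlled_tempered_at r : exists r' : nat, forall phi,
  tempered_chain_at T x0 r phi -> tempered_chain_at T y0 r' (D phi).
Proof.
have A0 : 0 <= A := le_trans ler01 A1.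
have Ar0 : 0 <= A * r%:R + B by rewrite addr_ge0// mulr_ge0.
exists (Num.bound (A * r%:R + B)) => phi Tphi; have [phir _ Fphi] := Tphi; split.
- move=> s i j sij; apply/eqP; apply: contraTT sij => /linear_extension_neq0.
  move=> [t [k [phit -> _]]]; rewrite -leNgt (le_trans _ (ltW (archi_boundP Ar0)))//.
  have [_] := sigmaAB t k; apply=> i' j'; rewrite leNgt.
  by apply: contraNN phit => /phir ->.
- move=> s; apply: contraNeq => /linear_extension_neq0[t [k [_ _ ->]]] //.
- apply/function_space_bounded1; move/function_space_bounded1: Fphi.
  apply: (function_bounded_transfer (N := N%:R) A1 B0) => // _ ->.
  by exists (row_mass phi) => //; apply: controlled_dominated_mass; exists r.
Qed.

Lemma controlled_tempered phi : tempered_chain T x0 phi -> tempered_chain T y0 (D phi).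
Proof.
by move=> [r rphi]; have [r' H] := controlled_tempered_at r; exists r'; exact: H.
Qed.

Lemma controlled_tempered_bounded S :
  tempered_bounded T x0 S -> tempered_bounded T y0 (D @` S).
Proof.
move=> [r [Sr bS]]; have [r' H] := controlled_tempered_at r; exists r'; split.
  by move=> _ [phi /Sr/H ? <-].
apply: (function_bounded_transfer (N := N%:R) A1 B0 _ _ bS) => //.
move=> _ [_ [phi Sphi <-] <-]; exists (row_mass phi); first by exists phi.
by apply: controlled_dominated_mass; exists r; exact: Sr.
Qed.

End ControlledFamilies.

(** * Coarse equivalences and the homotopies *)

Section CoarseMaps.
Context {R : realType}.

Definition coarse_lipschitz (X Y : metricType R) (A B : R) (f : X -> Y) : Prop :=
  forall x x', mdist (f x) (f x') <= A * mdist x x' + B.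

Lemma coarse_lipschitz_id (X : metricType R) : coarse_lipschitz 1 0 (@id X).
Proof. by move=> x x'; rewrite mul1r addr0. Qed.

Lemma coarse_lipschitz_comp (X Y Z : metricType R) A B A' B' (f : X -> Y) (g : Y -> Z) :
  0 <= A' -> coarse_lipschitz A B f -> coarse_lipschitz A' B' g ->
  coarse_lipschitz (A' * A) (A' * B + B') (g \o f).
Proof.
move=> A0 lf lg x x'; apply: le_trans (lg _ _) _.
have := ler_wpM2l A0 (lf x x'); lra.
Qed.

Lemma coarse_lipschitz_le (X Y : metricType R) A B A' B' (f : X -> Y) :
  A <= A' -> B <= B' -> coarse_lipschitz A B f -> coarse_lipschitz A' B' f.
Proof.
move=> AA BB lf x x'; apply: le_trans (lf _ _) _.
have := ler_wpM2r (mdist_ge0 x x') AA; lra.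
Qed.

(** The coarse inverse picks [g y] with [f (g y)] close to [y]; the lower bound in
    the definition of a quasi-isometry then makes [g] coarsely Lipschitz and
    [g (f x)] close to [x]. *)
Lemma quasi_isometric_inverse (X Y : metricType R) : quasi_isometric X Y ->
  exists (f : X -> Y) (g : Y -> X) (A B : R),
    [/\ 1 <= A, 0 <= B, coarse_lipschitz A B f, coarse_lipschitz A B g &
        (forall x, mdist x (g (f x)) <= B) /\ (forall y, mdist y (f (g y)) <= B)].
Proof.
move=> [f [[L [C [L1 C0 fLC]]] [C' /choice[g fg]]]].
have L0 : 0 < L by lra.
have dX x x' : mdist x x' <= L * (mdist (f x) (f x') + C).
  have /andP[h _] := fLC x x'.
  rewrite -ler_pdivrMl//; lra.
have LC : C <= L * C by rewrite ler_peMl.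
(* This constant dominates [C], [C'] and the additive error of [g]. *)
exists f, g, L, (L * (2 * `|C'| + C) + `|C'|).
have nC : 0 <= `|C'| by [].
have CC : C' <= `|C'| by exact: ler_norm.
have LnC : 0 <= L * `|C'| by rewrite mulr_ge0// ltW.
have LC0 : 0 <= L * C by rewrite mulr_ge0// ltW.
split=> //; first lra.
- by move=> x x'; have /andP[_ h] := fLC x x'; lra.
- move=> y y'; apply: le_trans (dX _ _) _.
  have t1 := metric_triangle (f (g y)) y (f (g y')).
  have t2 := metric_triangle y y' (f (g y')).
  have h : mdist (f (g y)) (f (g y')) + C <= mdist y y' + (2 * `|C'| + C).
    by have := fg y; have := fg y'; rewrite (metric_sym (f (g y'))) => ? ?; lra.
  by have := ler_wpM2l (ltW L0) h; lra.
split=> [x|y].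
  apply: le_trans (dX _ _) _; have := fg (f x); rewrite metric_sym => h.
  have h' : mdist (f x) (f (g (f x))) + C <= 2 * `|C'| + C by lra.
  by have := ler_wpM2l (ltW L0) h'; lra.
by have := fg y; rewrite metric_sym; lra.
Qed.

End CoarseMaps.

Section ReducedComplexes.
Context {R : realType} (T : growth R).

Lemma reduced_chain_tempered (X : metricType R) (x0 : X) n phi :
  reduced_chain T x0 (n := n) phi -> tempered_chain T x0 phi.
Proof. by case: n phi => [|n] phi; [case=> h _; exact: h|exact]. Qed.

Lemma reduced_chain_degenerate (X : metricType R) (x0 : X) n phi t :
  reduced_chain T x0 (n := n) phi -> ~~ nondegenerate t -> phi t = 0.
Proof. by move=> /reduced_chain_tempered[r [_ h _]] /h. Qed.

Lemma reduced_abs_summable (X : metricType R) (x0 : X) n phi :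
  proper_metric X -> reduced_chain T x0 (n := n) phi -> abs_summable phi.
Proof. by move=> pX /reduced_chain_tempered; exact: tempered_abs_summable. Qed.

Section TwoSpaces.
Variables (X Y : metricType R) (x0 : X) (y0 : Y).
Hypothesis pX : proper_metric X.

Lemma controlled_bounded_linear n m N A B
    (sigma : n.+1.-tuple X -> 'I_N -> m.+1.-tuple Y) :
  1 <= A -> 0 <= B -> controlled_family x0 y0 A B sigma ->
  (forall u, reduced_chain T x0 u ->
    reduced_chain T y0 (linear_extension (alternating_chain sigma) u)) ->
  @bounded_linear R (reduced_term T x0 n) (reduced_term T y0 m)
    (linear_extension (alternating_chain sigma)).
Proof.
move=> A1 B0 sAB red; split=> [u|a u v ru rv|S [Sred Sbnd]].
- exact: red.
- apply/funext => s.
  apply: linear_extension_linear; first exact: (reduced_abs_summable (n := n) pX ru).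
  exact: (reduced_abs_summable (n := n) pX rv).
- split; first by move=> _ [u Su <-]; apply: red; exact: Sred.
  exact: (controlled_tempered_bounded A1 B0 sAB).
Qed.

Lemma controlled_pushforward (f : X -> Y) A B n :
  0 <= A -> 0 <= B -> coarse_lipschitz A B f ->
  controlled_family x0 y0 A (B + mdist (f x0) y0)
    (fun (t : n.+1.-tuple X) (_ : 'I_1) => map_tuple f t).
Proof.
move=> A0 B0 lf t _; have d0 := mdist_ge0 (f x0) y0; split=> [|r tr i j].
  rewrite /thead tnth_map.
  have := metric_triangle (f (tnth t ord0)) (f x0) y0.
  by have := lf (tnth t ord0) x0; lra.
rewrite !tnth_map; apply: le_trans (lf _ _) _.
by have := ler_wpM2l A0 (tr i j); lra.
Qed.

Lemma bounded_linear_pushforward (f : X -> Y) A B n :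
  1 <= A -> 0 <= B -> coarse_lipschitz A B f ->
  @bounded_linear R (reduced_term T x0 n) (reduced_term T y0 n)
    (chain_pushforward f (n := n.+1)).
Proof.
move=> A1 B0 lf; have A0 : 0 <= A by lra.
have BB : 0 <= B + mdist (f x0) y0 by rewrite addr_ge0// mdist_ge0.
have cf m := controlled_pushforward (n := m) A0 B0 lf.
apply: (controlled_bounded_linear A1 BB (cf n)).
case: n => [|n] u /=.
  move=> [Tu au]; split; first exact: (controlled_tempered A1 BB (cf 0)).
  by rewrite -au; apply: augmentation_pushforward; exact: tempered_abs_summable Tu.
exact: (controlled_tempered A1 BB (cf n.+1)).
Qed.

Lemma bounded_chain_map_pushforward (f : X -> Y) A B :
  1 <= A -> 0 <= B -> coarse_lipschitz A B f ->
  @bounded_chain_map R (reduced_complex T x0) (reduced_complex T y0)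
    (fun n => chain_pushforward f (n := n.+1)).
Proof.
move=> A1 B0 lf; split=> [n|n u /= ru].
  exact: bounded_linear_pushforward lf.
by apply: boundary_pushforward; exact: (reduced_abs_summable (n := n.+1) pX ru).
Qed.

Lemma tnth_prism (f g : X -> Y) n (t : n.+1.-tuple X) (i : 'I_n.+1) k :
  exists a,
    tnth (prism f g t i) k = f (tnth t a) \/
    tnth (prism f g t i) k = g (tnth t a).
Proof.
have := ltn_ord k; have := ltn_ord i => i_n k_n.
rewrite tnth_mktuple; case: leqP => ki.
  have kn : (k < n.+1)%N by lia.
  by exists (Ordinal kn); left; rewrite (tnth_nth (thead t)).
have kn : (k.-1 < n.+1)%N by lia.
by exists (Ordinal kn); right; rewrite (tnth_nth (thead t)).
Qed.

Lemma controlled_prism (f g : X -> Y) A B n : 0 <= A -> 0 <= B ->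
  coarse_lipschitz A B f -> coarse_lipschitz A B g ->
  (forall x, mdist (f x) (g x) <= B) ->
  controlled_family x0 y0 A (2 * B + mdist (f x0) y0)
    (fun (t : n.+1.-tuple X) (i : 'I_n.+1) => prism f g t i).
Proof.
move=> A0 B0 lf lg fg t i; have d0 := mdist_ge0 (f x0) y0; split=> [|r tr].
  rewrite /thead tnth_mktuple /=.
  rewrite (_ : nth _ _ _ = tnth t ord0); last by rewrite (tnth_nth (thead t)).
  have := metric_triangle (f (tnth t ord0)) (f x0) y0.
  by have := lf (tnth t ord0) x0; lra.
have ff a b : mdist (f (tnth t a)) (f (tnth t b)) <= A * r + B.
  by apply: le_trans (lf _ _) _; have := ler_wpM2l A0 (tr a b); lra.
have gg a b : mdist (g (tnth t a)) (g (tnth t b)) <= A * r + B.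
  by apply: le_trans (lg _ _) _; have := ler_wpM2l A0 (tr a b); lra.
have mixed a b : mdist (f (tnth t a)) (g (tnth t b)) <= A * r + 2 * B.
  have := metric_triangle (f (tnth t a)) (f (tnth t b)) (g (tnth t b)).
  by have := ff a b; have := fg (tnth t b); lra.
move=> j k; have [a [] ->] := tnth_prism f g t i j;
  have [b [] ->] := tnth_prism f g t i k.
- by have := ff a b; lra.
- by have := mixed a b; lra.
- by rewrite metric_sym; have := mixed b a; lra.
- by have := gg a b; lra.
Qed.

(** Close maps induce homotopic maps: the edges that the prism adds between [f x]
    and [g x] have bounded length, so the prism operator is again bounded. *)
Lemma close_pushforward_homotopic (f g : X -> Y) A B :
  1 <= A -> 0 <= B -> coarse_lipschitz A B f -> coarse_lipschitz A B g ->
  (forall x, mdist (f x) (g x) <= B) ->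
  @boundedly_homotopic R (reduced_complex T x0) (reduced_complex T y0)
    (fun n => chain_pushforward g (n := n.+1)) (fun n => chain_pushforward f (n := n.+1)).
Proof.
move=> A1 B0 lf lg fg; have A0 : 0 <= A by lra.
have BB : 0 <= 2 * B + mdist (f x0) y0 by rewrite addr_ge0 ?mulr_ge0 ?mdist_ge0.
have cp n := controlled_prism (n := n) A0 B0 lf lg fg.
exists (fun n => prism_operator f g (n := n)); split=> [n|u ru|n u ru].
- apply: (controlled_bounded_linear A1 BB (cp n)) => u /reduced_chain_tempered.
  exact: (controlled_tempered A1 BB (cp n)).
- apply/funext => s; apply/esym/boundary_prism_operator0.
  exact: (reduced_abs_summable (n := 0) pX ru).
- apply/funext => s; apply/esym/boundary_prism_operatorS.
  exact: (reduced_abs_summable (n := n.+1) pX ru).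
Qed.

End TwoSpaces.

Lemma pushforward_inverse_homotopic (X Y : metricType R) (x0 : X) (y0 : Y)
    (f : X -> Y) (g : Y -> X) A B : proper_metric X -> 1 <= A -> 0 <= B ->
  coarse_lipschitz A B f -> coarse_lipschitz A B g ->
  (forall x, mdist x (g (f x)) <= B) ->
  @boundedly_homotopic R (reduced_complex T x0) (reduced_complex T x0)
    (fun n u => chain_pushforward g (n := n.+1) (chain_pushforward f (n := n.+1) u))
    (fun n u => u).
Proof.
move=> pX A1 B0 lf lg gf; have A0 : 0 <= A by lra.
have AA : 1 <= A * A by nra.
have AB : 0 <= A * B by rewrite mulr_ge0.
(* The pair [(id, g \o f)] with common constants [A * A] and [A * B + B]. *)
have lgf := coarse_lipschitz_comp A0 lf lg.
have lid : coarse_lipschitz (A * A) (A * B + B) (@id X).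
  by apply: (coarse_lipschitz_le AA _ (@coarse_lipschitz_id _ X)); lra.
have BB : 0 <= A * B + B by lra.
have cl x : mdist (id x) ((g \o f) x) <= A * B + B by have := gf x; rewrite /=; lra.
have [h [hbl h0 hS]] := close_pushforward_homotopic x0 x0 pX AA BB lid lgf cl.
have E n u : reduced_chain T x0 (n := n) u ->
    chain_pushforward g (chain_pushforward f u) = chain_pushforward (g \o f) u /\
    chain_pushforward id u = u.
  move=> ru; split; first exact/pushforward_comp/(reduced_abs_summable pX ru).
  by apply: pushforward_id => t; exact: reduced_chain_degenerate ru.
exists h; split=> // [u ru|n u ru].
  by rewrite -(h0 u ru); have [-> ->] := E 0 u ru.
by rewrite -(hS n u ru); have [-> ->] := E n.+1 u ru.
Qed.

End ReducedComplexes.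

Theorem proposition2 (R : realType) (X Y : metricType R) (x0 : X) (y0 : Y)
    (T : growth R) :
  discrete_metric X -> proper_metric X ->
  discrete_metric Y -> proper_metric Y ->
  quasi_isometric X Y ->
  bornologically_homotopy_equivalent
    (reduced_complex T x0) (reduced_complex T y0).
Proof.
move=> _ pX _ pY /quasi_isometric_inverse[f [g [A [B [A1 B0 lf lg [gf fg]]]]]].
exists (fun n => chain_pushforward f (n := n.+1)),
  (fun n => chain_pushforward g (n := n.+1)).
split.
- exact: bounded_chain_map_pushforward lf.
- exact: bounded_chain_map_pushforward lg.
- exact: pushforward_inverse_homotopic lf lg gf.
- exact: pushforward_inverse_homotopic lg lf fg.
Qed.
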